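(* For all $n\ge0$, with $\boldsymbol\pi_n=(\pi_{n+1},\pi_n,\pi_{n-1})^T$ and $\boldsymbol\eta_n=(\eta_{n+1},\eta_n,\eta_{n-1})^T$, $$\partial_{s}\boldsymbol\pi_n = \mathcal{B}^{(\infty,0)}_{n}\boldsymbol\pi_n - \xi s^{a}e^{-s} \tfrac{1}{\eta_{n}}\Big[ \tfrac{S_{n}}{S_{n+1}}Q^{(1)}_{n+1}(-s)-(X_{n,n}-s)Q^{(1)}_{n}(-s)-\tfrac{S_{n-1}}{S_{n}}Q^{(1)}_{n-1}(-s) \Big]\mathbf P_n(s),$$ $$\partial_{t}\boldsymbol\pi_n = \mathcal{C}^{(\infty,0)}_{n}\boldsymbol\pi_n - \psi t^{b}e^{-t} \tfrac{1}{\eta_{n}}\Big[ \tfrac{S_{n}}{S_{n+1}}Q_{n+1}(t)-(X_{n,n}+t)Q_{n}(t)-\tfrac{S_{n-1}}{S_{n}}Q_{n-1}(t) \Big]\mathbf P^{(1)}_n(-t),$$ $$\partial_{s}\boldsymbol\eta_n = \mathcal{B}^{(\infty,\bar0)}_{n}\boldsymbol\eta_n - \xi s^{a}e^{-s} \tfrac{1}{\pi_{n}}\Big[ \tfrac{S_{n}}{S_{n+1}}P_{n+1}(s)-(Y_{n,n}+s)P_{n}(s)-\tfrac{S_{n-1}}{S_{n}}P_{n-1}(s) \Big]\mathbf Q^{(1)}_n(-s),$$ $$\partial_{t}\boldsymbol\eta_n = \mathcal{C}^{(\infty,\bar0)}_{n}\boldsymbol\eta_n - \psi t^{b}e^{-t}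 \tfrac{1}{\pi_{n}}\Big[ \tfrac{S_{n}}{S_{n+1}}P^{(1)}_{n+1}(-t)-(Y_{n,n}-t)P^{(1)}_{n}(-t)-\tfrac{S_{n-1}}{S_{n}}P^{(1)}_{n-1}(-t) \Big]\mathbf Q_n(t).$$
   Context: Fix $a,b,\xi,\psi\in\mathbb C$ with $\Re a,\Re b>-1$. For $s,t>0$ put $w_1(x)=(1-\xi\chi_{x>s})x^ae^{-x}$, $w_2(y)=(1-\psi\chi_{y>t})y^be^{-y}$ on $(0,\infty)$, $\langle f,g\rangle=\int_0^\infty\int_0^\infty\frac{w_1(x)w_2(y)}{x+y}f(x)g(y)\,dx\,dy$, $M_{j,k}=\langle x^j,y^k\rangle$, $Z_0=1$, $Z_n=\det(M_{j,k})_{0\le j,k\le n-1}$. $P_n,Q_n$ are polynomials of degree $n$ with the same leading coefficient $S_n$ ($S_n^2=Z_n/Z_{n+1}$, branch chosen differentiably in $(s,t)$) and $\langle P_m,Q_n\rangle=\delta_{m,n}$. $\pi_n=\int_0^\infty w_1P_n\,dx$, $\eta_n=\int_0^\infty w_2Q_n\,dy$, $X_{n,n}=\langle xP_n,Q_n\rangle$, $Y_{n,n}=\langle P_n,yQ_n\rangle$. Objects with index $-1$ are $0$. $(s,t)$ ranges over an open set on which the standing generic conditions hold: all $M_{j,k}$ finite (absolutely convergent), $Z_n\ne0$, $\pi_n,\eta_n\neq0$ for all $n\ge0$. $P^{(1)}_n(z)=\int_0^\infty\frac{w_1(x)}{z-x}P_n(x)\,dx$, $Q^{(1)}_n(z)=\int_0^\infty\frac{w_2(y)}{z-y}Q_n(y)\,dy$.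 $\mathbf P_n(z)=(P_{n+1},P_n,P_{n-1})^T$, $\mathbf P^{(1)}_n(z)=(P^{(1)}_{n+1},P^{(1)}_n,P^{(1)}_{n-1})^T$, similarly $\mathbf Q_n$, $\mathbf Q_n^{(1)}$. Matrices: $$\mathcal{B}^{(\infty,0)}_{n} = \tfrac{1}{2}\xi s^{a}e^{-s}\begin{pmatrix} P_{n+1}(s)Q^{(1)}_{n+1}(-s) & 0 & 0\\ 0 & -P_{n}(s)Q^{(1)}_{n}(-s) & 0\\ 0 & -2P_{n-1}(s)Q^{(1)}_{n}(-s) & -P_{n-1}(s)Q^{(1)}_{n-1}(-s)\end{pmatrix},$$ $\mathcal{B}^{(\infty,\bar0)}_{n}$ is the same with the $(3,2)$ entry of the displayed matrix replaced by $-2P_{n}(s)Q^{(1)}_{n-1}(-s)$; $$\mathcal{C}^{(\infty,0)}_{n} = \tfrac{1}{2}\psi t^{b}e^{-t}\begin{pmatrix} P^{(1)}_{n+1}(-t)Q_{n+1}(t) & 0 & 0\\ 0 & -P^{(1)}_{n}(-t)Q_{n}(t) & 0\\ 0 & -2P^{(1)}_{n-1}(-t)Q_{n}(t) & -P^{(1)}_{n-1}(-t)Q_{n-1}(t)\end{pmatrix},$$ $\mathcal{C}^{(\infty,\bar0)}_{n}$ is the same with the $(3,2)$ entry of the displayed matrix replaced by $-2P^{(1)}_{n}(-t)Q_{n-1}(t)$. *)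

(* Defs.v *)
From HB Require Import structures.
From mathcomp Require Export all_boot all_order all_algebra.
From mathcomp Require Export complex.
From mathcomp Require Export all_classical all_reals all_analysis.

Export Order.TTheory GRing.Theory Num.Theory.
Export numFieldNormedType.Exports.

Set Implicit Arguments.
Unset Strict Implicit.
Unset Printing Implicit Defensive.

Local Open Scope classical_set_scope.
Local Open Scope ring_scope.
Local Open Scope complex_scope.

(* [R[i]] carries no real normed-module or measurable structure in the
   libraries, so integration, derivatives and differentiability of
   complex-valued functions are taken on the real and imaginary parts. *)

Definition cintegrable (R : realType) d (T : measurableType d)
    (mu : {measure set T -> \bar R}) (D : set T) (f : T -> R[i]) : Prop :=
  mu.-integrable D (fun x => (complex.Re (f x))%:E) /\
  mu.-integrable D (fun x => (complex.Im (f x))%:E).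

Definition cintegral (R : realType) d (T : measurableType d)
    (mu : {measure set T -> \bar R}) (D : set T) (f : T -> R[i]) : R[i] :=
  Rintegral mu D (fun x => complex.Re (f x))
    +i* Rintegral mu D (fun x => complex.Im (f x)).

Definition cis_derive (R : realType) (f : R -> R[i]) (x : R) (l : R[i]) : Prop :=
  is_derive x (1 : R) (fun u => complex.Re (f u)) (complex.Re l) /\
  is_derive x (1 : R) (fun u => complex.Im (f u)) (complex.Im l).

Definition vis_derive (R : realType) m (f : R -> 'cV[R[i]]_m) (x : R)
    (l : 'cV[R[i]]_m) : Prop :=
  forall i : 'I_m, cis_derive (fun u => f u i 0) x (l i 0).

Definition cdifferentiable (R : realType) (f : R -> R -> R[i]) (p : R * R) : Prop :=
  differentiable (fun q : R * R => complex.Re (f q.1 q.2)) p /\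
  differentiable (fun q : R * R => complex.Im (f q.1 q.2)) p.

Definition cexp (R : realType) (z : R[i]) : R[i] :=
  (expR (complex.Re z))%:C * (cos (complex.Im z) +i* sin (complex.Im z)).

(* Principal value; only meaningful for [0 < x]. *)
Definition cpow (R : realType) (x : R) (a : R[i]) : R[i] := cexp (a * (ln x)%:C).

Definition laguerre (R : realType) (e : R[i]) (x : R) : R[i] :=
  cpow x e * (expR (- x))%:C.

(* [w_1 = weight xi s a] and [w_2 = weight psi t b]. *)
Definition weight (R : realType) (c : R[i]) (r : R) (e : R[i]) (x : R) : R[i] :=
  (1 - c * (r < x)%R%:R) * laguerre e x.

Definition halfline (R : realType) : set (measurableTypeR R) :=
  [set x : R | 0 < x].

Definition quadrant (R : realType) : set (measurableTypeR R * measurableTypeR R) :=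
  [set p : R * R | 0 < p.1 /\ 0 < p.2].

Section BilinearForm.
Context (R : realType).
Implicit Types (w v : R -> R[i]) (f g p : {poly R[i]}).

Definition mean w p : R[i] :=
  cintegral (@lebesgue_measure R) (@halfline R) (fun x : R => w x * p.[x%:C]).

Definition second_kind w p (z : R[i]) : R[i] :=
  cintegral (@lebesgue_measure R) (@halfline R) (fun x : R => w x / (z - x%:C) * p.[x%:C]).

Definition pairing_fun w v f g (q : R * R) : R[i] :=
  w q.1 * v q.2 / (q.1 + q.2)%:C * f.[q.1%:C] * g.[q.2%:C].

(* The double integral is taken against the product measure; under
   [pairing_finite] it agrees with the iterated integrals by Fubini. *)
Definition pairing w v f g : R[i] :=
  cintegral (@lebesgue_measure R \x @lebesgue_measure R)%E (@quadrant R)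
    (pairing_fun w v f g).

Definition pairing_finite w v f g : Prop :=
  cintegrable (@lebesgue_measure R \x @lebesgue_measure R)%E (@quadrant R)
    (pairing_fun w v f g).

Definition moment w v (j k : nat) : R[i] := pairing w v 'X^j 'X^k.

Definition partition_function w v (n : nat) : R[i] :=
  \det (\matrix_(j < n, k < n) moment w v j k).

End BilinearForm.

(* [prev u n] is [u_{n-1}], with [u_{-1} = 0]. *)
Definition prev (V : zmodType) (u : nat -> V) (n : nat) : V :=
  if n is m.+1 then u m else 0.

Definition vec3 (K : fieldType) (u : nat -> K) (n : nat) : 'cV[K]_3 :=
  \col_(i < 3) [:: u n.+1; u n; prev u n]`_i.

(* The common shape of the four coefficient matrices, with [u_k v_k] up to sign
   on the diagonal and [e] in position (3,2). *)
Definition coef_mx (K : fieldType) (c : K) (u v : nat -> K) (e : K) (n : nat) :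
    'M[K]_3 :=
  (2^-1 * c) *: \matrix_(i < 3, j < 3)
    (nth [::] [:: [:: u n.+1 * v n.+1; 0;             0];
                  [:: 0;               - (u n * v n); 0];
                  [:: 0;               e;             - (prev u n * prev v n)]]
         i)`_j.

Definition bracket (K : fieldType) (S : nat -> K) (x : K) (u : nat -> K) (n : nat) : K :=
  S n / S n.+1 * u n.+1 - x * u n - prev S n / S n * prev u n.

Section System.
Context (R : realType).
Variables (a b xi psi : R[i]) (P Q : R -> R -> nat -> {poly R[i]}).
Implicit Types (s t : R) (n : nat) (z : R[i]).

Definition w1 s : R -> R[i] := weight xi s a.
Definition w2 t : R -> R[i] := weight psi t b.

Definition pi_ s t n : R[i] := mean (w1 s) (P s t n).
Definition eta_ s t n : R[i] := mean (w2 t) (Q s t n).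

Definition Xdiag s t n : R[i] := pairing (w1 s) (w2 t) ('X * P s t n) (Q s t n).
Definition Ydiag s t n : R[i] := pairing (w1 s) (w2 t) (P s t n) ('X * Q s t n).

Definition Pval s t z n : R[i] := (P s t n).[z].
Definition Qval s t z n : R[i] := (Q s t n).[z].
Definition P1val s t z n : R[i] := second_kind (w1 s) (P s t n) z.
Definition Q1val s t z n : R[i] := second_kind (w2 t) (Q s t n) z.

Definition Binf0 s t n : 'M[R[i]]_3 :=
  let u := Pval s t s%:C in let v := Q1val s t (- s%:C) in
  coef_mx (xi * laguerre a s) u v (- 2 * prev u n * v n) n.

Definition Binf0bar s t n : 'M[R[i]]_3 :=
  let u := Pval s t s%:C in let v := Q1val s t (- s%:C) in
  coef_mx (xi * laguerre a s) u v (- 2 * u n * prev v n) n.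

Definition Cinf0 s t n : 'M[R[i]]_3 :=
  let u := P1val s t (- t%:C) in let v := Qval s t t%:C in
  coef_mx (psi * laguerre b t) u v (- 2 * prev u n * v n) n.

Definition Cinf0bar s t n : 'M[R[i]]_3 :=
  let u := P1val s t (- t%:C) in let v := Qval s t t%:C in
  coef_mx (psi * laguerre b t) u v (- 2 * u n * prev v n) n.

End System.

(* Main.v *)
From HB Require Import structures.
Require Import Defs.
From mathcomp Require Import ring lra measurable_realfun.

(** Moving the jump [s] of [w1] changes the moments by a rank-one amount, with
    derivative [- c * alpha_j * beta_k], [c = xi s^a e^-s], where [alpha] is
    evaluation at [s] and [beta] is the second-kind functional of [w2] at [-s];
    likewise for [t]. Put [u_n = alpha (P_n)], [v_n = beta (Q_n)].
    Differentiating [<P_n, y^k> = delta_{nk} / S_n], [k <= n], gives the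
    coordinates [c u_n v_k] of the derivative of [P_n] on [P_k], [k < n]; the one
    on [P_n] is [c u_n v_n / 2], because [P_n] and [Q_n] have the same leading
    coefficient. The sums [sum_(k <= n) pi_k v_k] that this produces in the
    derivative of [pi_n] are closed by a Christoffel-Darboux identity: expand
    [y Q_n] on the [Q_m] and use [<x f, g> + <f, y g> = (int w1 f) (int w2 g)].
    The equations for [eta] are those for [pi] with the two weights exchanged. *)

Set Implicit Arguments.
Unset Strict Implicit.
Unset Printing Implicit Defensive.

Local Open Scope classical_set_scope.
Local Open Scope ring_scope.
Local Open Scope complex_scope.

(** * Biorthogonal polynomials *)

Section LinearForm.
Context (K : fieldType).
Implicit Types (m : nat -> K) (M : nat -> nat -> K) (f g p : {poly K}).

(** The functional with moments [m]. Evaluation at a point, the mean and the second-kind integral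
    all take this form, by [lform_horner], [mean_lform] and [second_kind_lform]. *)
Definition lform m p : K := \sum_(j < size p) p`_j * m j.

Lemma lformE m p N : (size p <= N)%N -> lform m p = \sum_(j < N) p`_j * m j.
Proof.
move=> pN; rewrite /lform (big_ord_widen _ (fun j => p`_j * m j) pN) big_mkcond.
by apply: eq_bigr => j _; case: ltnP => // pj; rewrite nth_default ?mul0r.
Qed.

Lemma lform_is_linear m : linear_for *%R (lform m).
Proof.
move=> a p q; set N := maxn (size p) (size q).
have pN : (size p <= N)%N by rewrite leq_maxl.
have qN : (size q <= N)%N by rewrite leq_maxr.
have apqN : (size (a *: p + q)%R <= N)%N.
  by rewrite (leq_trans (size_polyD _ _))// geq_max (leq_trans (size_scale_leq _ _)).
rewrite !(lformE m (N := N))// mulr_sumr -big_split/=.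
by apply: eq_bigr => j _; rewrite coefD coefZ mulrDl mulrA.
Qed.

HB.instance Definition _ m := GRing.isLinear.Build K {poly K} K *%R (lform m)
  (lform_is_linear m).

Lemma lformXn m n : lform m 'X^n = m n.
Proof.
rewrite (lformE m (N := n.+1)) ?size_polyXn// big_ord_recr/= big1 => [|j _].
  by rewrite coefXn eqxx mul1r add0r.
by rewrite coefXn ltn_eqF// mul0r.
Qed.

Lemma poly_sum_Xn p N : (size p <= N)%N -> p = \sum_(j < N) p`_j *: 'X^j.
Proof.
move=> pN; rewrite -poly_def; apply/polyP => i; rewrite coef_poly.
by case: ltnP => // Ni; rewrite nth_default// (leq_trans pN).
Qed.

Lemma lform_horner z p : lform (fun j => z ^+ j) p = p.[z].
Proof. by rewrite /lform horner_coef. Qed.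

(** Nesting two functionals makes linearity in [f] an instance of linearity of [lform]; linearity in
    [g] is reached through [bform_tr]. *)
Definition bform M f g : K := lform (fun j => lform (M j) g) f.

Lemma bformE M f g N N' : (size f <= N)%N -> (size g <= N')%N ->
  bform M f g = \sum_(j < N) \sum_(k < N') f`_j * (g`_k * M j k).
Proof.
move=> fN gN; rewrite /bform (lformE _ fN); apply: eq_bigr => j _.
by rewrite (lformE _ gN) mulr_sumr.
Qed.

Lemma bform_tr M f g : bform M f g = bform (fun j k => M k j) g f.
Proof.
rewrite !(bformE _ (leqnn _) (leqnn _)) exchange_big.
by apply: eq_bigr => j _; apply: eq_bigr => k _; ring.
Qed.

End LinearForm.

Section Biorthogonal.
Context (K : fieldType) (M : nat -> nat -> K) (P Q : nat -> {poly K}) (S : nat -> K).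
Hypothesis sizeP : forall n, size (P n) = n.+1.
Hypothesis leadP : forall n, lead_coef (P n) = S n.
Hypothesis orth : forall m n, bform M (P m) (Q n) = (m == n)%:R.

Lemma leading_neq0 n : S n != 0.
Proof. by rewrite -leadP lead_coef_eq0 -size_poly_eq0 sizeP. Qed.

Lemma coef_leading n : (P n)`_n = S n.
Proof. by rewrite -leadP /lead_coef sizeP. Qed.

(** Induction on the degree: subtracting a multiple of [P n] removes the top coefficient, so some
    expansion exists. Pairing it with [Q k] identifies its coefficients. *)
Lemma biorthogonal_expand n (f : {poly K}) : (size f <= n)%N ->
  f = \sum_(k < n) bform M f (Q k) *: P k.
Proof.
move=> fn; suff [d fE] : exists d : nat -> K, f = \sum_(k < n) d k *: P k.
  rewrite {1}fE; apply: eq_bigr => k _; congr (_ *: _).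
  rewrite fE /bform linear_sum/= (bigD1 k)//= big1 => [|j jk].
    by rewrite linearZ/= [lform _ _]orth eqxx mulr1 addr0.
  by rewrite linearZ/= [lform _ _]orth -[(j == k :> nat)]/(j == k) (negPf jk) mulr0.
elim: n f fn => [|n IH] f fn.
  exists (fun=> 0); rewrite big_ord0; apply/eqP.
  by rewrite -size_poly_eq0 -leqn0.
have [|d dE] := IH (f - (f`_n / S n) *: P n).
  apply/leq_sizeP => j; rewrite leq_eqVlt => /predU1P[<-|nj].
    by rewrite coefB coefZ coef_leading mulfVK ?subrr// leading_neq0.
  rewrite coefB coefZ [f`_j]nth_default ?(leq_trans fn)//.
  by rewrite [(P n)`_j]nth_default ?sizeP// mulr0 subrr.
exists (fun k => if k == n then f`_n / S n else d k).
rewrite big_ord_recr/= eqxx -[LHS](subrK ((f`_n / S n) *: P n)) dE.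
by congr (_ + _); apply: eq_bigr => k _; rewrite ltn_eqF.
Qed.

(** In the expansion of [f] only [P n] reaches degree [n]; the coefficients of ['X^n] are
    compared. *)
Lemma bform_leading n (f : {poly K}) : (size f <= n.+1)%N -> bform M f (Q n) = f`_n / S n.
Proof.
move=> fn; have /(congr1 (fun p : {poly K} => p`_n)) := biorthogonal_expand fn.
rewrite coef_sum big_ord_recr/= big1 => [|k _].
  by rewrite add0r coefZ coef_leading => ->; rewrite mulfK// leading_neq0.
by rewrite coefZ nth_default ?mulr0// sizeP.
Qed.

End Biorthogonal.

(** * A Christoffel-Darboux identity for the Cauchy kernel *)

Section ChristoffelDarboux.
Context (K : fieldType) (M : nat -> nat -> K) (P Q : nat -> {poly K}) (S : nat -> K).
Hypothesis sizeP : forall n, size (P n) = n.+1.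
Hypothesis sizeQ : forall n, size (Q n) = n.+1.
Hypothesis leadP : forall n, lead_coef (P n) = S n.
Hypothesis leadQ : forall n, lead_coef (Q n) = S n.
Hypothesis orth : forall m n, bform M (P m) (Q n) = (m == n)%:R.
Variables (L E : {poly K} -> K) (beta : {scalar {poly K}}) (sigma eps : K).
Hypothesis moment_shift : forall f g,
  bform M ('X * f) g + bform M f ('X * g) = L f * E g.
Hypothesis beta_shift : forall g, beta ('X * g) = sigma * beta g - eps * E g.

Let orth_tr m n : bform (fun j k => M k j) (Q m) (P n) = (m == n)%:R.
Proof. by rewrite -bform_tr orth eq_sym. Qed.

(** [L] and [E] stand for the means against the two weights. The functional [beta] is either the
    second-kind integral at [-s], with [sigma = -s] and [eps = 1], or evaluation at [t], with
    [sigma = t] and [eps = 0]. The identity compares two values of [beta (y Q_n)]: the one given by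
    [beta_shift], and the one obtained by expanding [y Q_n] on the [Q_k]. *)
Lemma second_kind_kernel n :
  E (Q n) * (eps + \sum_(k < n.+1) L (P k) * beta (Q k)) =
  - bracket S (bform M ('X * P n) (Q n) + sigma) (fun k => beta (Q k)) n.
Proof.
have sizeXP k : size ('X * P k) = k.+2.
  by rewrite mulrC size_mulX ?sizeP// -size_poly_eq0 sizeP.
have sizeXQ k : size ('X * Q k) = k.+2.
  by rewrite mulrC size_mulX ?sizeQ// -size_poly_eq0 sizeQ.
have coefP k : (P k)`_k = S k by apply: coef_leading.
have coefQ k : (Q k)`_k = S k by apply: coef_leading.
have := beta_shift (Q n).
(* [y Q_n] has degree [n + 1]; its coordinate on [Q_(n+1)] is the ratio [S_n / S_(n+1)] of leading
   coefficients. *)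
rewrite [X in beta X](biorthogonal_expand sizeQ leadQ orth_tr (n := n.+2)) ?sizeXQ//.
rewrite linear_sum/= big_ord_recr/= linearZ/=.
rewrite (bform_leading sizeQ leadQ orth_tr) ?sizeXQ// coefXM/= coefQ.
(* [moment_shift] trades the coordinate [<P_k, y Q_n>] for [L (P_k) E (Q_n) - <x P_k, Q_n>]; the
   products assemble into the kernel sum. *)
have -> : \sum_(k < n.+1) beta (bform (fun j l => M l j) ('X * Q n) (P k) *: Q k) =
    E (Q n) * (\sum_(k < n.+1) L (P k) * beta (Q k)) -
    \sum_(k < n.+1) bform M ('X * P k) (Q n) * beta (Q k).
  rewrite mulr_sumr -sumrB; apply: eq_bigr => k _; rewrite linearZ/= -bform_tr.
  have -> : bform M (P k) ('X * Q n) =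
      L (P k) * E (Q n) - bform M ('X * P k) (Q n).
    by rewrite -moment_shift addrC addKr.
  ring.
rewrite [X in _ - X + _]big_ord_recr/=.
(* For [k < n], the degree of [x P_k] is at most [n], so its pairing with [Q_n] sees only the
   coefficient of index [n], which is nonzero for [k = n - 1] alone. *)
have -> : \sum_(k < n) bform M ('X * P k) (Q n) * beta (Q k) =
    prev S n / S n * prev (fun k => beta (Q k)) n.
  case: n => [|n]; first by rewrite big_ord0/= !mul0r.
  rewrite big_ord_recr/= big1 => [|k _].
    by rewrite add0r (bform_leading sizeP leadP orth) ?sizeXP// coefXM/= coefP.
  rewrite (bform_leading sizeP leadP orth); last by rewrite sizeXP ltnW// !ltnS.
  by rewrite nth_default ?mul0r// sizeXP !ltnS.
rewrite /bracket; set A := \sum_(_ < _) _; set X := bform _ _ _.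
set b1 := beta (Q n.+1); set b0 := beta (Q n); set bp := prev (fun k => beta (Q k)) n.
move=> H; have -> : E (Q n) * (eps + A) = eps * E (Q n) + E (Q n) * A by ring.
have -> : eps * E (Q n) = sigma * b0 -
   (E (Q n) * A - (prev S n / S n * bp + X * b0) + S n / S n.+1 * b1).
  by rewrite H; ring.
ring.
Qed.

End ChristoffelDarboux.

(** * Calculus of complex-valued functions of a real variable *)

Section ReIm.
Context (R : realType).
Implicit Types z w : R[i].

Lemma ReD z w : complex.Re (z + w) = complex.Re z + complex.Re w.
Proof. by case: z; case: w. Qed.

Lemma ImD z w : complex.Im (z + w) = complex.Im z + complex.Im w.
Proof. by case: z; case: w. Qed.

Lemma ReM z w : complex.Re (z * w) =
  complex.Re z * complex.Re w - complex.Im z * complex.Im w.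
Proof. by case: z; case: w. Qed.

Lemma ImM z w : complex.Im (z * w) =
  complex.Re z * complex.Im w + complex.Im z * complex.Re w.
Proof. by case: z; case: w. Qed.

Lemma complex_ext z w :
  complex.Re z = complex.Re w -> complex.Im z = complex.Im w -> z = w.
Proof. by case: z; case: w => ? ? ? ? /= -> ->. Qed.

Lemma ReV z : complex.Re z^-1 =
  complex.Re z * (complex.Re z ^+ 2 + complex.Im z ^+ 2)^-1.
Proof. by case: z. Qed.

Lemma ImV z : complex.Im z^-1 =
  - complex.Im z * (complex.Re z ^+ 2 + complex.Im z ^+ 2)^-1.
Proof. by case: z => a b /=; rewrite mulNr. Qed.

End ReIm.

Section ComplexDerivative.
Context (R : realType) (x : R).
Implicit Types (f g : R -> R[i]) (l : R[i]).

Lemma cis_derive_unique f l l' : cis_derive f x l -> cis_derive f x l' -> l = l'.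
Proof.
by move=> [[_ a] [_ b]] [[_ a'] [_ b']]; apply: complex_ext; congruence.
Qed.

Lemma cis_derive_near f g l : (\forall y \near x, f y = g y) ->
  cis_derive f x l -> cis_derive g x l.
Proof.
move=> fg [fr fi]; split.
  by apply: near_eq_is_derive fr; apply: filterS fg => y ->.
by apply: near_eq_is_derive fi; apply: filterS fg => y ->.
Qed.

Lemma cis_derive_cst l : cis_derive (fun=> l) x 0.
Proof. by split; exact: is_derive_cst. Qed.

Lemma cis_deriveD f g l l' : cis_derive f x l -> cis_derive g x l' ->
  cis_derive (fun y => f y + g y) x (l + l').
Proof.
move=> [fr fi] [gr gi]; split.
  rewrite ReD (_ : (fun y => _) = (@complex.Re R \o f) + (@complex.Re R \o g)).
    exact: is_deriveD.
  by apply/funext => y; rewrite ReD.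
rewrite ImD (_ : (fun y => _) = (@complex.Im R \o f) + (@complex.Im R \o g)).
  exact: is_deriveD.
by apply/funext => y; rewrite ImD.
Qed.

Lemma cis_deriveM f g l l' : cis_derive f x l -> cis_derive g x l' ->
  cis_derive (fun y => f y * g y) x (l * g x + f x * l').
Proof.
move=> [fr fi] [gr gi]; split.
  rewrite (_ : (fun y => _) = (@complex.Re R \o f) * (@complex.Re R \o g) -
    (@complex.Im R \o f) * (@complex.Im R \o g)).
    apply: is_derive_eq; rewrite /= ReD !ReM /GRing.scale/=; ring.
  by apply/funext => y; rewrite ReM.
rewrite (_ : (fun y => _) = (@complex.Re R \o f) * (@complex.Im R \o g) +
  (@complex.Im R \o f) * (@complex.Re R \o g)).
  apply: is_derive_eq; rewrite /= ImD !ImM /GRing.scale/=; ring.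
by apply/funext => y; rewrite ImM.
Qed.

Lemma cis_derive_sum (I : Type) (r : seq I) (F : I -> R -> R[i]) (l : I -> R[i]) :
  (forall i, cis_derive (F i) x (l i)) ->
  cis_derive (fun y => \sum_(i <- r) F i y) x (\sum_(i <- r) l i).
Proof.
move=> Fl; elim: r => [|i r IH].
  rewrite big_nil (_ : (fun y => _) = fun=> 0); first exact: cis_derive_cst.
  by apply/funext => y; rewrite big_nil.
rewrite big_cons (_ : (fun y => _) = fun y => F i y + \sum_(i <- r) F i y).
  exact: cis_deriveD.
by apply/funext => y; rewrite big_cons.
Qed.

Definition cderivable f := exists l, cis_derive f x l.

Lemma cderivable_cst l : cderivable (fun=> l).
Proof. by exists 0; exact: cis_derive_cst. Qed.

Lemma cderivableM f g : cderivable f -> cderivable g -> cderivable (fun y => f y * g y).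
Proof. by move=> [l fl] [l' gl']; exists (l * g x + f x * l'); exact: cis_deriveM. Qed.

Lemma cderivable_sum (I : Type) (r : seq I) (F : I -> R -> R[i]) :
  (forall i, cderivable (F i)) -> cderivable (fun y => \sum_(i <- r) F i y).
Proof. by move=> /choice[l Fl]; exists (\sum_(i <- r) l i); exact: cis_derive_sum. Qed.

Lemma cderivable_prod (I : Type) (r : seq I) (F : I -> R -> R[i]) :
  (forall i, cderivable (F i)) -> cderivable (fun y => \prod_(i <- r) F i y).
Proof.
move=> Fl; elim: r => [|i r IH].
  rewrite (_ : (fun y => _) = fun=> 1); first exact: cderivable_cst.
  by apply/funext => y; rewrite big_nil.
rewrite (_ : (fun y => _) = fun y => F i y * \prod_(i <- r) F i y).
  exact: cderivableM.
by apply/funext => y; rewrite big_cons.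
Qed.

Lemma cderivableV f : f x != 0 -> cderivable f -> cderivable (fun y => (f y)^-1).
Proof.
move=> fx0 [l [fr fi]].
(* [N] is the squared modulus of [f], and the inverse of [f] is its conjugate over [N]. *)
pose N := (@complex.Re R \o f) ^+ 2 + (@complex.Im R \o f) ^+ 2.
have Nx0 : N x != 0.
  apply: contra fx0.
  rewrite /N /= -[(_ + _) x]/(complex.Re (f x) ^+ 2 + complex.Im (f x) ^+ 2).
  rewrite paddr_eq0 ?sqr_ge0// !sqrf_eq0 => /andP[/eqP a0 /eqP b0].
  by apply/eqP/complex_ext.
have [n' Nn'] : exists n', is_derive x 1 N n' by eexists.
have NV := is_deriveV Nx0 Nn'.
have Rf : is_derive x 1 (@complex.Re R \o f) (complex.Re l) by [].
have If : is_derive x 1 (@complex.Im R \o f) (complex.Im l) by [].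
eexists (_ +i* _); split.
  rewrite (_ : (fun y => _) = (@complex.Re R \o f) * (fun y => (N y)^-1)) /=.
    exact: is_deriveM Rf NV.
  by apply/funext => y; rewrite ReV.
rewrite (_ : (fun y => _) = (- (@complex.Im R \o f)) * (fun y => (N y)^-1)) /=.
  exact: is_deriveM (is_deriveN If) NV.
by apply/funext => y; rewrite ImV.
Qed.

Lemma cderivable_det n (A : R -> 'M[R[i]]_n) :
  (forall i j, cderivable (fun y => A y i j)) -> cderivable (fun y => \det (A y)).
Proof.
move=> Ad; apply: cderivable_sum => s; apply: cderivableM (cderivable_cst _) _.
by apply: cderivable_prod => i; exact: Ad.
Qed.

(** Cramer's rule. [invmx] agrees with the cofactor formula only on invertible matrices, hence the
    condition on a whole neighbourhood of [x]. *)
Lemma cderivable_invmx n (A : R -> 'M[R[i]]_n) i j :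
  (\forall y \near x, \det (A y) != 0) ->
  (forall i j, cderivable (fun y => A y i j)) ->
  cderivable (fun y => invmx (A y) i j).
Proof.
move=> A0 Ad; have [||l ml] := @cderivableM (fun y => (\det (A y))^-1)
    (fun y => (-1) ^+ (j + i) * \det (row' j (col' i (A y)))).
- by apply: cderivableV; [exact: nbhs_singleton A0|exact: cderivable_det].
- apply: cderivableM (cderivable_cst _) _; apply: cderivable_det => k k'.
  rewrite (_ : (fun y => _) = fun y => A y (lift j k) (lift i k')); first exact: Ad.
  by apply/funext => y; rewrite !mxE.
exists l; apply: cis_derive_near ml; apply: filterS A0 => y A0.
by rewrite /invmx unitmxE unitfE A0 !mxE.
Qed.

End ComplexDerivative.

(** * Evolution under a rank-one change of the moments *)

Section Evolution.
Context (R : realType) (x : R).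
Variables (M : R -> nat -> nat -> R[i]) (mu : R -> nat -> R[i]).
Variables (P Q : R -> nat -> {poly R[i]}) (S : R -> nat -> R[i]).
Hypothesis sizeP : \forall y \near x, forall n, size (P y n) = n.+1.
Hypothesis sizeQ : \forall y \near x, forall n, size (Q y n) = n.+1.
Hypothesis leadP : \forall y \near x, forall n, lead_coef (P y n) = S y n.
Hypothesis leadQ : \forall y \near x, forall n, lead_coef (Q y n) = S y n.
Hypothesis orth : \forall y \near x, forall m n,
  bform (M y) (P y m) (Q y n) = (m == n)%:R.
Hypothesis det_neq0 : \forall y \near x, forall n,
  \det (\matrix_(j < n, k < n) M y j k) != 0.
Variables (c eps : R[i]) (alpha beta : nat -> R[i]).
Hypothesis dM : forall j k, cis_derive (fun y => M y j k) x (- (c * alpha j * beta k)).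
Hypothesis dmu : forall j, cis_derive (fun y => mu y j) x (c * eps * alpha j).
Hypothesis dS : forall n, cderivable x (fun y => S y n).

(** [bform_leading] for the transposed form, applied to ['X^k]. For fixed [n] this is a square
    linear system for the coefficients of [P_n], whose right-hand side involves only [S_n]. *)
Lemma bform_Xn n : \forall y \near x, forall k : 'I_n.+1,
  \sum_(j < n.+1) (P y n)`_j * M y j k = ((k : nat) == n)%:R * (S y n)^-1.
Proof.
near=> y => k.
have sP : forall n, size (P y n) = n.+1 by near: y.
have sQ : forall n, size (Q y n) = n.+1 by near: y.
have lP : forall n, lead_coef (P y n) = S y n by near: y.
have lQ : forall n, lead_coef (Q y n) = S y n by near: y.
have o : forall m n, bform (M y) (P y m) (Q y n) = (m == n)%:R by near: y.
have o' m n' : bform (fun j k => M y k j) (Q y m) (P y n') = (m == n')%:R.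
  by rewrite -bform_tr o eq_sym.
have := bform_leading sQ lQ o' (n := n) (f := 'X^k).
rewrite size_polyXn => /(_ (ltn_ord k)); rewrite coefXn eq_sym => <-.
rewrite -bform_tr /bform (lformE _ (N := n.+1)) ?sP//.
by apply: eq_bigr => j _; rewrite lformXn.
Unshelve. all: by end_near. Qed.

Lemma S_neq0 n : S x n != 0.
Proof.
rewrite -(nbhs_singleton leadP) lead_coef_eq0 -size_poly_eq0.
by rewrite (nbhs_singleton sizeP).
Qed.

(** Differentiability of [P_n] is not assumed: it comes from that of [S_n] and of the moments, by
    solving the system [bform_Xn] with the inverse moment matrix. *)
Lemma cderivable_coef n j : cderivable x (fun y => (P y n)`_j).
Proof.
have [nj|jn] := ltnP n j.
  exists 0; apply: (@cis_derive_near _ _ (fun=> 0)); last exact: cis_derive_cst.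
  by apply: filterS sizeP => y sP; rewrite nth_default// sP.
pose A y : 'M[R[i]]_n.+1 := \matrix_(j < n.+1, k < n.+1) M y j k.
have [||l dl] := @cderivableM _ x (fun y => (S y n)^-1)
    (fun y => invmx (A y) ord_max (inord j)).
- by apply: cderivableV; [exact: S_neq0|exact: dS].
- apply: cderivable_invmx => [|i k]; first by apply: filterS det_neq0.
  rewrite (_ : (fun y => _) = fun y => M y i k); last first.
    by apply/funext => y; rewrite mxE.
  by eexists; exact: dM.
exists l; apply: cis_derive_near dl; near=> y.
have Au : A y \in unitmx.
  by rewrite unitmxE unitfE; have : forall n, \det (\matrix_(j < n, k < n) M y j k) != 0
    by near: y.
have : (\row_(j < n.+1) (P y n)`_j) *m A y = (S y n)^-1 *: delta_mx 0 ord_max.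
  apply/rowP => k; rewrite !mxE eqxx/= mulrC.
  have -> : (k == ord_max) = ((k : nat) == n) by [].
  have <- : \sum_(j < n.+1) (P y n)`_j * M y j k = ((k : nat) == n)%:R * (S y n)^-1.
    by move: k; near: y; exact: bform_Xn.
  by apply: eq_bigr => i _; rewrite !mxE.
move=> /(congr1 (mulmx^~ (invmx (A y)))); rewrite mulmxK// -scalemxAl -rowE.
by move/rowP => /(_ (inord j)); rewrite !mxE inordK.
Unshelve. all: by end_near. Qed.

Let L := lform (mu x).
Let u k := lform alpha (P x k).
Let v k := lform beta (Q x k).

Let sP n : size (P x n) = n.+1. Proof. exact: (nbhs_singleton sizeP). Qed.
Let sQ n : size (Q x n) = n.+1. Proof. exact: (nbhs_singleton sizeQ). Qed.
Let lP n : lead_coef (P x n) = S x n. Proof. exact: (nbhs_singleton leadP). Qed.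
Let lQ n : lead_coef (Q x n) = S x n. Proof. exact: (nbhs_singleton leadQ). Qed.
Let o m n : bform (M x) (P x m) (Q x n) = (m == n)%:R.
Proof. exact: (nbhs_singleton orth). Qed.

Lemma derive_poly n : exists D : {poly R[i]}, [/\ (size D <= n.+1)%N,
  forall j, cis_derive (fun y => (P y n)`_j) x D`_j &
  D = (c * u n) *: ((v n / 2) *: P x n + \sum_(k < n) v k *: P x k)].
Proof.
have /choice[d dE] := cderivable_coef n.
have [s ds] := dS n; have [s' ds'] := cderivableV (S_neq0 n) (dS n).
pose D := \poly_(j < n.+1) d j.
have sD : (size D <= n.+1)%N by rewrite size_poly.
have d0 j : (n < j)%N -> d j = 0.
  move=> nj; apply: (cis_derive_unique (dE j)).
  apply: (@cis_derive_near _ _ (fun=> 0)); last exact: cis_derive_cst.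
  by apply: filterS sizeP => y szP; rewrite nth_default// szP.
have DE j : D`_j = d j by rewrite coef_poly; case: ltnP => // /d0 ->.
have Dn : D`_n = s.
  rewrite DE; apply: (cis_derive_unique (dE n)).
  apply: cis_derive_near ds; near=> y.
  have sPy : forall n, size (P y n) = n.+1 by near: y.
  have <- : lead_coef (P y n) = S y n by near: y; apply: filterS leadP.
  by rewrite /lead_coef sPy.
(* [s] and [s'] are the derivatives of [S_n] and of its inverse; the product [S_n^-1 S_n = 1] is
   differentiated. *)
have s'E : s' * S x n = - (s / S x n).
  have S0 : \forall y \near x, S y n != 0.
    near=> y; have <- : lead_coef (P y n) = S y n by near: y; apply: filterS leadP.
    rewrite lead_coef_eq0 -size_poly_eq0.
    by have -> : size (P y n) = n.+1 by near: y; apply: filterS sizeP.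
  have : s' * S x n + (S x n)^-1 * s = 0.
    apply: (cis_derive_unique (cis_deriveM ds' ds)).
    apply: (@cis_derive_near _ _ (fun=> 1)); last exact: cis_derive_cst.
    by apply: filterS S0 => y S0; rewrite mulVf.
  by move/eqP; rewrite addr_eq0 => /eqP ->; rewrite mulrC.
(* Both sides of [bform_Xn] are differentiated. The rank-one derivative of the moments contributes
   [- c u_n beta_k], which is moved to the right. *)
have DX (k : 'I_n.+1) : bform (M x) D 'X^k = c * u n * beta k + ((k : nat) == n)%:R * s'.
  have H1 : cis_derive (fun y => \sum_(j < n.+1) (P y n)`_j * M y j k) x
      (\sum_(j < n.+1) (D`_j * M x j k + (P x n)`_j * - (c * alpha j * beta k))).
    by apply: cis_derive_sum => j; rewrite DE; exact: cis_deriveM (dE j) (dM j k).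
  have H2 : cis_derive (fun y => ((k : nat) == n)%:R * (S y n)^-1) x
      (0 * (S x n)^-1 + ((k : nat) == n)%:R * s').
    exact: cis_deriveM (cis_derive_cst _ _) ds'.
  have := cis_derive_unique H1 (cis_derive_near _ H2).
  rewrite big_split/= mul0r add0r => <-.
    rewrite /bform (lformE _ sD).
    under [LHS]eq_bigr do rewrite lformXn.
    rewrite addrCA -[LHS]addr0; congr (_ + _); apply/esym.
    rewrite /u (lformE _ (N := n.+1)) ?sP// mulr_sumr mulr_suml.
    rewrite -big_split/= big1// => j _.
    ring.
  near=> y; apply/esym; move: k {H1 H2}; near: y; exact: bform_Xn.
have Dg (g : {poly R[i]}) : (size g <= n.+1)%N ->
    bform (M x) D g = c * u n * lform beta g + g`_n * s'.
  move=> gn; rewrite {1}(poly_sum_Xn gn) bform_tr /bform linear_sum/=.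
  rewrite (lformE _ gn) mulr_sumr.
  transitivity (\sum_(k < n.+1) g`_k * (c * u n * beta k + ((k : nat) == n)%:R * s')).
    apply: eq_bigr => k _; rewrite -DX linearZ/=; congr (_ * _).
    by rewrite [RHS]bform_tr.
  rewrite (eq_bigr (fun k : 'I_n.+1 => c * u n * (g`_k * beta k) +
    g`_k * ((k : nat) == n)%:R * s')) => [|k _]; last by ring.
  rewrite big_split/=; congr (_ + _).
  rewrite big_ord_recr/= big1 ?eqxx ?mulr1 ?add0r// => k _.
  by rewrite ltn_eqF// mulr0 mul0r.
(* [Q_k] with [k < n] has no coefficient of index [n], so the term in [s'] disappears. *)
have DP (k : 'I_n) : bform (M x) D (Q x k) = c * u n * v k.
  rewrite Dg ?sQ; last by rewrite ltnS ltnW.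
  by rewrite nth_default ?sQ// mul0r addr0.
have Qn : (Q x n)`_n = S x n by rewrite -lQ /lead_coef sQ.
(* Origin of the factor 1/2: [<D, Q_n>] equals [s / S_n] by the leading coefficient of [D], and
   [c u_n v_n - s / S_n] by the differentiated system. Adding the two eliminates the unknown [s]. *)
have DQ : bform (M x) D (Q x n) = c * u n * v n / 2.
  have E1 : bform (M x) D (Q x n) = s / S x n.
    by rewrite (bform_leading sP lP o)// Dn.
  have E2 : bform (M x) D (Q x n) = c * u n * v n - s / S x n.
    by rewrite Dg ?sQ// Qn mulrC [_ * s']mulrC s'E mulrC.
  have : bform (M x) D (Q x n) + bform (M x) D (Q x n) = c * u n * v n.
    by rewrite {1}E2 E1 subrK.
  by move=> <-; field.
exists D; split=> // [j|]; first by rewrite DE.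
rewrite (biorthogonal_expand sP lP o sD) big_ord_recr/= DQ addrC scalerDr.
congr (_ + _); first by rewrite scalerA mulrA.
by rewrite scaler_sumr; apply: eq_bigr => k _; rewrite DP scalerA.
Unshelve. all: by end_near. Qed.

(** Product rule: the derivative of the moments [mu] contributes [c eps u_n], and the rest is [L]
    applied to the derivative of [P_n] from [derive_poly]. *)
Lemma derive_mean n : cis_derive (fun y => lform (mu y) (P y n)) x
  (c * u n * (eps + L (P x n) * v n / 2 + \sum_(k < n) L (P x k) * v k)).
Proof.
have [D [sD dP DE]] := derive_poly n.
have H : cis_derive (fun y => \sum_(j < n.+1) (P y n)`_j * mu y j) x
    (\sum_(j < n.+1) (D`_j * mu x j + (P x n)`_j * (c * eps * alpha j))).
  by apply: cis_derive_sum => j; exact: cis_deriveM.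
apply: cis_derive_near.
  by apply: filterS sizeP => y sPy; rewrite (lformE _ (N := n.+1)) ?sPy.
rewrite big_split/= -(lformE _ sD) in H.
have HE : c * u n * (eps + L (P x n) * v n / 2 + \sum_(k < n) L (P x k) * v k) =
  lform (mu x) D + \sum_(i < n.+1) (P x n)`_i * (c * eps * alpha i).
  rewrite DE linearZ/= linearD/= linearZ/= linear_sum/=.
  under [in RHS]eq_bigr do rewrite linearZ/=.
  rewrite (_ : \sum_(i < n.+1) _ = c * eps * u n); last first.
    rewrite /u (lformE _ (N := n.+1)) ?sP// mulr_sumr.
    by apply: eq_bigr => j _; ring.
  under [in LHS]eq_bigr do rewrite mulrC.
  by rewrite -/L; ring.
by rewrite HE.
Qed.

Variables (E : {poly R[i]} -> R[i]) (sigma : R[i]).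
Hypothesis moment_shift : forall f g,
  bform (M x) ('X * f) g + bform (M x) f ('X * g) = L f * E g.
Hypothesis beta_shift : forall g,
  lform beta ('X * g) = sigma * lform beta g - eps * E g.
Hypothesis E_neq0 : forall n, E (Q x n) != 0.

(** By [second_kind_kernel] the bracket term supplies, in all three rows, the same sum over
    [k <= n]. The matrix corrects it: row [n + 1] gains half of its own term; row [n] loses half of
    the last term; row [n - 1] loses the whole term of index [n], which is the entry in position
    (3,2), and half of the term of index [n - 1]. *)
Theorem derive_mean_vec n :
  vis_derive (fun y => vec3 (fun k => lform (mu y) (P y k)) n) x
    (coef_mx c u v (- 2 * prev u n * v n) n *m vec3 (fun k => L (P x k)) n
     - (c * (E (Q x n))^-1 *
        bracket (S x) (bform (M x) ('X * P x n) (Q x n) + sigma) v n) *: vec3 u n).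
Proof.
have BE : bracket (S x) (bform (M x) ('X * P x n) (Q x n) + sigma) v n =
    - (E (Q x n) * (eps + \sum_(k < n.+1) L (P x k) * v k)).
  by rewrite (second_kind_kernel sP sQ lP lQ o moment_shift beta_shift) opprK.
have FE : c * (E (Q x n))^-1 *
    bracket (S x) (bform (M x) ('X * P x n) (Q x n) + sigma) v n =
    - (c * (eps + \sum_(k < n.+1) L (P x k) * v k)).
  rewrite BE mulrN; congr (- _).
  by rewrite -mulrA; congr (_ * _); rewrite mulrA mulVf// mul1r.
rewrite FE scaleNr opprK.
have vE (f : nat -> R[i]) (i : 'I_3) : vec3 f n i 0 = [:: f n.+1; f n; prev f n]`_i.
  by rewrite mxE.
move=> i.
rewrite (_ : (fun y => _) = fun y => [:: lform (mu y) (P y n.+1); lform (mu y) (P y n);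
  prev (fun k => lform (mu y) (P y k)) n]`_i); last by apply/funext => y; rewrite vE.
rewrite !mxE big_ord_recl big_ord_recl big_ord_recl big_ord0 !mxE.
case: i => -[|[|[|//]]] i3 /=.
- have dn := derive_mean n.+1.
  rewrite (_ : _ + _ = c * u n.+1 * (eps + L (P x n.+1) * v n.+1 / 2 +
    \sum_(k < n.+1) L (P x k) * v k)); first exact: dn.
  by field.
- have dn := derive_mean n.
  rewrite (_ : _ + _ = c * u n * (eps + L (P x n) * v n / 2 +
    \sum_(k < n) L (P x k) * v k)); first exact: dn.
  by rewrite big_ord_recr/=; field.
(* At [n = 0] the third row carries the index -1: the function is constantly 0, and so is the
   right-hand side since [prev u 0 = 0]. *)
case: n {BE FE vE} i3 => [|n] i3 /=.
  rewrite (_ : _ + _ = 0); first exact: cis_derive_cst.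
  by ring.
have dn := derive_mean n.
rewrite (_ : _ + _ = c * u n * (eps + L (P x n) * v n / 2 +
    \sum_(k < n) L (P x k) * v k)); first exact: dn.
by rewrite !big_ord_recr/=; field.
Qed.

End Evolution.

(** * Complex-valued integrals *)

Section ComplexIntegral.
Context (R : realType) d (T : measurableType d) (mu : {measure set T -> \bar R}).
Context (D : set T).
Hypothesis mD : measurable D.
Implicit Types (f g : T -> R[i]) (c : R[i]).

Lemma eq_cintegrable f g : (forall x, D x -> f x = g x) ->
  cintegrable mu D f -> cintegrable mu D g.
Proof.
move=> fg [fr fi]; split.
  by apply: eq_integrable fr => // x /set_mem Dx /=; rewrite fg.
by apply: eq_integrable fi => // x /set_mem Dx /=; rewrite fg.
Qed.

Lemma eq_cintegral f g : (forall x, D x -> f x = g x) ->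
  cintegral mu D f = cintegral mu D g.
Proof.
by move=> fg; congr (_ +i* _); apply: eq_Rintegral => x /set_mem Dx; rewrite fg.
Qed.

Lemma cintegrableD f g : cintegrable mu D f -> cintegrable mu D g ->
  cintegrable mu D (fun x => f x + g x).
Proof.
move=> [fr fi] [gr gi]; split.
  apply: eq_integrable (integrableD mD fr gr) => // x _ /=.
  by rewrite ReD EFinD.
apply: eq_integrable (integrableD mD fi gi) => // x _ /=.
by rewrite ImD EFinD.
Qed.

Lemma cintegralD f g : cintegrable mu D f -> cintegrable mu D g ->
  cintegral mu D (fun x => f x + g x) = cintegral mu D f + cintegral mu D g.
Proof.
move=> [fr fi] [gr gi]; apply: complex_ext.
  rewrite ReD /= -RintegralD//.
  by apply: eq_Rintegral => x _; rewrite ReD.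
rewrite ImD /= -RintegralD//.
by apply: eq_Rintegral => x _; rewrite ImD.
Qed.

Lemma cintegrableZ c f : cintegrable mu D f -> cintegrable mu D (fun x => c * f x).
Proof.
move=> [fr fi]; split.
  apply: eq_integrable (integrableB mD (integrableZl mD (complex.Re c) fr)
    (integrableZl mD (complex.Im c) fi)) => // x _ /=.
  by rewrite ReM EFinB !EFinM.
apply: eq_integrable (integrableD mD (integrableZl mD (complex.Re c) fi)
  (integrableZl mD (complex.Im c) fr)) => // x _ /=.
by rewrite ImM EFinD !EFinM.
Qed.

Lemma cintegralZ c f : cintegrable mu D f ->
  cintegral mu D (fun x => c * f x) = c * cintegral mu D f.
Proof.
move=> [fr fi]; apply: complex_ext.
  rewrite ReM /= -!RintegralZl// -RintegralB//; last 2 first.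
  - exact: (integrableZl mD (complex.Re c) fr).
  - exact: (integrableZl mD (complex.Im c) fi).
  by apply: eq_Rintegral => x _; rewrite ReM.
rewrite ImM /= -!RintegralZl// -RintegralD//; last 2 first.
- exact: (integrableZl mD (complex.Re c) fi).
- exact: (integrableZl mD (complex.Im c) fr).
by apply: eq_Rintegral => x _; rewrite ImM.
Qed.

Lemma cintegrableB f g : cintegrable mu D f -> cintegrable mu D g ->
  cintegrable mu D (fun x => f x - g x).
Proof.
move=> fi /(cintegrableZ (-1)) /(cintegrableD fi); apply: eq_cintegrable => x _.
by rewrite mulN1r.
Qed.

Lemma cintegralB f g : cintegrable mu D f -> cintegrable mu D g ->
  cintegral mu D (fun x => f x - g x) = cintegral mu D f - cintegral mu D g.
Proof.
move=> fi gi; rewrite -mulN1r -cintegralZ// -cintegralD//; last exact: cintegrableZ.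
by apply: eq_cintegral => x _; rewrite mulN1r.
Qed.

Lemma cintegrable_sum (I : Type) (r : seq I) (a : I -> R[i]) (F : I -> T -> R[i]) :
  (forall i, cintegrable mu D (F i)) ->
  cintegrable mu D (fun x => \sum_(i <- r) a i * F i x).
Proof.
move=> Fi; elim: r => [|i r IH].
  apply: (@eq_cintegrable (fun=> 0)) => [x _|]; first by rewrite big_nil.
  by split; exact: integrable0.
apply: eq_cintegrable (cintegrableD (cintegrableZ (a i) (Fi i)) IH) => x _.
by rewrite big_cons.
Qed.

Lemma cintegral_sum (I : Type) (r : seq I) (a : I -> R[i]) (F : I -> T -> R[i]) :
  (forall i, cintegrable mu D (F i)) ->
  cintegral mu D (fun x => \sum_(i <- r) a i * F i x) =
  \sum_(i <- r) a i * cintegral mu D (F i).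
Proof.
move=> Fi; elim: r => [|i r IH].
  rewrite (@eq_cintegral _ (fun=> 0)) => [|x _]; last by rewrite big_nil.
  by rewrite big_nil /cintegral /Rintegral integral0.
rewrite big_cons -IH -cintegralZ// -cintegralD; last 2 first.
- exact: cintegrableZ.
- exact: cintegrable_sum.
by apply: eq_cintegral => x _; rewrite big_cons.
Qed.

Lemma cintegrable_realM f (h : T -> R) : measurable_fun D h ->
  [bounded h x | x in D] -> cintegrable mu D f ->
  cintegrable mu D (fun x => f x * (h x)%:C).
Proof.
move=> mh bh [fr fi]; split.
  apply: eq_integrable (integrableMl mD fr mh bh) => // x _ /=.
  by rewrite ReM /= mulr0 subr0 EFinM.
apply: eq_integrable (integrableMl mD fi mh bh) => // x _ /=.
by rewrite ImM /= mulr0 add0r EFinM.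
Qed.

End ComplexIntegral.

(** * Exchange of the variables in a product integral *)

Section ProductSwap.
Context d1 d2 (T1 : measurableType d1) (T2 : measurableType d2) (R : realType).
Variable m1 : {sigma_finite_measure set T1 -> \bar R}.
Variable m2 : {sigma_finite_measure set T2 -> \bar R}.
Variable f : T1 * T2 -> \bar R.
Hypothesis fi : (m1 \x m2)%E.-integrable setT f.

(** Tonelli: integrability can be tested on either iterated integral of the absolute value, and
    exchanging the variables exchanges the two tests. *)
Lemma integrable_swap : (m2 \x m1)%E.-integrable setT (fun p => f (p.2, p.1)).
Proof.
have mf := measurable_int _ fi.
apply/integrable12ltyP; last by have /integrable21ltyP := fi; apply.
apply: (measurable_comp measurableT) => //; exact: measurable_swap.
Qed.

Lemma integral_swap :
  (\int[m2 \x m1]_p f (p.2, p.1) = \int[m1 \x m2]_p f p)%E.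
Proof.
by rewrite -integral12_prod_meas1 ?integrable_swap// -integral21_prod_meas1.
Qed.

End ProductSwap.

(** * Fubini on the quadrant *)

Section QuadrantIntegral.
Context (R : realType).
Local Notation mu := (@lebesgue_measure R).
Local Notation mu2 := (mu \x mu)%E.
Local Notation H := (@halfline R).
Implicit Types (F : R * R -> R[i]).

Lemma measurable_halfline : measurable H.
Proof.
rewrite (_ : H = [set` `]0, +oo[]); first exact: measurable_itv.
by apply/seteqP; split => x /=; rewrite in_itv/= andbT.
Qed.

Lemma quadrantE : @quadrant R = H `*` H.
Proof. by []. Qed.

Lemma measurable_quadrant : measurable (@quadrant R).
Proof. by rewrite quadrantE; apply: measurableX; exact: measurable_halfline. Qed.

Let restrictE (f : R * R -> R) (x y : R) :
  ((fun p => (f p)%:E) \_ (@quadrant R)) (x, y) =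
  ((fun x => ((fun y => (f (x, y))%:E) \_ H) y) \_ H) x.
Proof.
rewrite !patchE; case: ifPn => [/set_mem [x0 y0]|].
  by rewrite !mem_set.
case: ifPn => // xH; case: ifPn => // yH; rewrite mem_set//.
by split; exact: set_mem.
Qed.

(** [Rintegral] passes through [fine]. Integrability of the section at every positive [x], not just
    almost every one, makes the inner integral finite, so that [fine] loses nothing there. *)
Lemma Rintegral_quadrant (f : R * R -> R) :
  mu2.-integrable (@quadrant R) (fun p => (f p)%:E) ->
  (forall x, 0 < x -> mu.-integrable H (fun y => (f (x, y))%:E)) ->
  Rintegral mu2 (@quadrant R) f =
  Rintegral mu H (fun x => Rintegral mu H (fun y => f (x, y))).
Proof.
move=> fi fxi; rewrite /Rintegral; congr fine.
rewrite [LHS]integral_mkcond -integral12_prod_meas1; last first.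
  by apply/(integrable_mkcond _ measurable_quadrant).
rewrite [RHS]integral_mkcond; apply: eq_integral => x _.
rewrite /fubini_F; under eq_integral do rewrite restrictE.
rewrite [RHS]patchE; case: ifPn => xH; last first.
  by apply: integral0_eq => y _; rewrite patchE (negPf xH).
rewrite fineK; last first.
  apply: integrable_fin_num; first exact: measurable_halfline.
  exact/fxi/(set_mem xH).
by rewrite [RHS]integral_mkcond; apply: eq_integral => y _; rewrite patchE xH.
Qed.

Lemma cintegral_quadrant F : cintegrable mu2 (@quadrant R) F ->
  (forall x, 0 < x -> cintegrable mu H (fun y => F (x, y))) ->
  cintegral mu2 (@quadrant R) F =
  cintegral mu H (fun x => cintegral mu H (fun y => F (x, y))).
Proof.
move=> [Fr Fi] Fx; apply: complex_ext => /=.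
  by rewrite Rintegral_quadrant// => x /Fx[].
by rewrite Rintegral_quadrant// => x /Fx[].
Qed.

(** Fubini yields almost every section only. This is enough to find one integrable section over an
    interval, as [all_finite_has_moments] requires. *)
Lemma integrable_quadrant_section (f : R * R -> R) :
  mu2.-integrable (@quadrant R) (fun p => (f p)%:E) ->
  {ae mu, forall y, 0 < y -> mu.-integrable H (fun x => (f (x, y))%:E)}.
Proof.
move=> /(integrable_mkcond _ measurable_quadrant) /ae_integrable2.
apply: filterS => y fy y0; apply/(integrable_mkcond _ measurable_halfline).
apply: eq_integrable fy => // x _; rewrite restrictE !patchE.
by case: ifPn => // xH; rewrite mem_set.
Qed.

Let restrict_swap (f : R * R -> R) : (fun p => (f (p.2, p.1))%:E) \_ (@quadrant R) =
  (fun p => ((fun p => (f p)%:E) \_ (@quadrant R)) (p.2, p.1)).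
Proof.
apply/funext => -[x y]; rewrite /= !restrictE !patchE.
by case: ifPn => // xH; case: ifPn.
Qed.

Lemma integrable_quadrant_swap (f : R * R -> R) :
  mu2.-integrable (@quadrant R) (fun p => (f p)%:E) ->
  mu2.-integrable (@quadrant R) (fun p => (f (p.2, p.1))%:E).
Proof.
move=> /(integrable_mkcond _ measurable_quadrant) fi.
apply/(integrable_mkcond _ measurable_quadrant); rewrite restrict_swap.
exact: integrable_swap.
Qed.

Lemma Rintegral_quadrant_swap (f : R * R -> R) :
  mu2.-integrable (@quadrant R) (fun p => (f p)%:E) ->
  Rintegral mu2 (@quadrant R) (fun p => f (p.2, p.1)) = Rintegral mu2 (@quadrant R) f.
Proof.
move=> fi; rewrite /Rintegral; congr fine.
rewrite [LHS]integral_mkcond [RHS]integral_mkcond restrict_swap.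
by rewrite (integral_swap (f := (fun p => (f p)%:E) \_ (@quadrant R)))//;
  apply/(integrable_mkcond _ measurable_quadrant).
Qed.

Lemma cintegrable_quadrant_swap F : cintegrable mu2 (@quadrant R) F ->
  cintegrable mu2 (@quadrant R) (fun p => F (p.2, p.1)).
Proof.
by move=> [Fr Fi]; split;
  [exact: integrable_quadrant_swap Fr|exact: integrable_quadrant_swap Fi].
Qed.

Lemma cintegral_quadrant_swap F : cintegrable mu2 (@quadrant R) F ->
  cintegral mu2 (@quadrant R) (fun p => F (p.2, p.1)) = cintegral mu2 (@quadrant R) F.
Proof.
move=> [Fr Fi]; apply: complex_ext => /=.
  exact: Rintegral_quadrant_swap Fr.
exact: Rintegral_quadrant_swap Fi.
Qed.

End QuadrantIntegral.

(** * Dependence on the jump of the weight *)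

Section ComplexContinuity.
Context (R : realType).
Implicit Types (f g : R -> R[i]) (x : R).

Definition ccontinuous f x :=
  {for x, continuous (fun y => complex.Re (f y))} /\
  {for x, continuous (fun y => complex.Im (f y))}.

Lemma ccontinuousM f g x : ccontinuous f x -> ccontinuous g x ->
  ccontinuous (fun y => f y * g y) x.
Proof.
move=> [fr fi] [gr gi]; split.
  rewrite (_ : (fun y => _) = (fun y => complex.Re (f y) * complex.Re (g y) -
      complex.Im (f y) * complex.Im (g y))); last by apply/funext => y; rewrite ReM.
  by apply: cvgB; exact: cvgM.
rewrite (_ : (fun y => _) = (fun y => complex.Re (f y) * complex.Im (g y) +
    complex.Im (f y) * complex.Re (g y))); last by apply/funext => y; rewrite ImM.
by apply: cvgD; exact: cvgM.
Qed.

Lemma ccontinuous_cst c x : ccontinuous (fun=> c) x.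
Proof. by split; exact: cvg_cst. Qed.

Lemma ccontinuous_real (h : R -> R) x : {for x, continuous h} ->
  ccontinuous (fun y => (h y)%:C) x.
Proof. by move=> hx; split => //=; exact: cvg_cst. Qed.

Lemma ccontinuousX n x : ccontinuous (fun y : R => y%:C ^+ n) x.
Proof.
elim: n => [|n IH]; first exact: ccontinuous_cst.
rewrite (_ : (fun y => _) = fun y : R => y%:C * y%:C ^+ n).
  by apply: ccontinuousM IH; apply: ccontinuous_real; exact: cvg_id.
by apply/funext => y; rewrite exprS.
Qed.

Lemma ccontinuous_laguerre e x : 0 < x -> ccontinuous (laguerre e) x.
Proof.
move=> x0; have lnx := continuous_ln x0.
apply: ccontinuousM; last first.
  apply: ccontinuous_real; apply: (@continuous_comp _ _ _ -%R expR); last exact: continuous_expR.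
  exact: oppr_continuous.
have eln : ccontinuous (fun y => e * (ln y)%:C) x.
  by apply: ccontinuousM; [exact: ccontinuous_cst|exact: ccontinuous_real].
case: eln => er ei; rewrite /cpow /cexp; apply: ccontinuousM.
  by apply: ccontinuous_real; apply: continuous_comp er _; exact: continuous_expR.
split => /=.
  by apply: continuous_comp ei _; exact: continuous_cos.
by apply: continuous_comp ei _; exact: continuous_sin.
Qed.

Lemma laguerre_neq0 e x : laguerre e x != 0.
Proof.
rewrite mulf_neq0//; last by rewrite (fmorph_eq0 (real_complex R)) gt_eqF// expR_gt0.
rewrite /cpow /cexp mulf_neq0//.
  by rewrite (fmorph_eq0 (real_complex R)) gt_eqF// expR_gt0.
set t := complex.Im _; apply/eqP => -[ct st].
by have := cos2Dsin2 t; rewrite ct st expr0n/= addr0 => /esym/eqP; rewrite oner_eq0.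
Qed.

End ComplexContinuity.

(** * Continuity and derivatives of integrals over the half-line *)

Section HalflineIntegral.
Context (R : realType).
Local Notation mu := (@lebesgue_measure R).
Local Notation H := (@halfline R).
Implicit Types (f : R -> R[i]).

Let mH := @measurable_halfline R.

Lemma cauchy_kernel_bound (x y : R) : 0 < x -> 0 < y -> `|(x + y)^-1| <= x^-1.
Proof.
move=> x0 y0; rewrite gtr0_norm ?invr_gt0 ?addr_gt0// lef_pV2 ?posrE ?addr_gt0//.
by rewrite lerDl ltW.
Qed.

Lemma measurable_cauchy_kernel (x : R) : 0 < x -> measurable_fun H (fun y => (x + y)^-1).
Proof.
move=> x0; apply: open_continuous_measurable_fun.
  rewrite (_ : H = [set` `]0, +oo[]); first exact: interval_open.
  by apply/seteqP; split => y /=; rewrite in_itv/= andbT.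
move=> y /set_mem y0; apply: continuousV; first by rewrite gt_eqF// addr_gt0.
by apply: cvgD; [exact: cvg_cst|exact: cvg_id].
Qed.

Lemma bounded_cauchy_kernel (x : R) : 0 < x -> [bounded (x + y)^-1 | y in H].
Proof.
move=> x0; exists x^-1; split; first exact: num_real.
move=> M xM y y0; apply: le_trans (ltW xM); exact: cauchy_kernel_bound.
Qed.

Lemma cintegrable_cauchy f (x : R) : 0 < x -> cintegrable mu H f ->
  cintegrable mu H (fun y => f y * ((x + y)^-1)%:C).
Proof.
move=> x0; apply: cintegrable_realM => //.
  exact: measurable_cauchy_kernel.
exact: bounded_cauchy_kernel.
Qed.

Lemma continuous_cauchy (r : R -> R) (x : R) : 0 < x ->
  mu.-integrable H (EFin \o r) ->
  {for x, continuous (fun x => Rintegral mu H (fun y => r y * (x + y)^-1))}.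
Proof.
move=> x0 ri.
have u0 : 0 < x / 2 by rewrite divr_gt0.
have I0 z : z \in `]x / 2, (x + 1)[%R -> 0 < z.
  by rewrite in_itv/= => /andP[/(lt_trans u0)].
(* Dominated convergence on the window from [x / 2] to [x + 1], which stays away from 0: there the
   kernel is at most [(x / 2)^-1]. *)
apply: (@continuity_under_integral R _ _ mu (fun x y => r y * (x + y)^-1) H mH
  (x / 2) (x + 1) _ _ (fun y => (x / 2)^-1 * `|r y|)).
- move=> z /I0 z0 /=.
  apply: eq_integrable (integrableMl mH ri (measurable_cauchy_kernel z0)
    (bounded_cauchy_kernel z0)) => // y _ /=.
- apply: aeW => y y0 z /set_mem /I0 z0.
  apply: cvgM; first exact: cvg_cst.
  apply: cvgV; first by rewrite gt_eqF// addr_gt0.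
  by apply: cvgD; [exact: cvg_id|exact: cvg_cst].
- by apply: eq_integrable (integrableZl mH (x / 2)^-1 (integrable_norm ri)).
- move=> z zI; apply: aeW => y y0; rewrite normrM mulrC ler_wpM2r//.
  have z0 := I0 _ zI; apply: le_trans (cauchy_kernel_bound z0 y0) _.
  by rewrite lef_pV2 ?posrE//; move: zI; rewrite /= in_itv/= => /andP[/ltW].
- by apply/mem_set; rewrite /= in_itv/=; apply/andP; split; lra.
Qed.

Lemma ccontinuous_cauchy f (x : R) : 0 < x -> cintegrable mu H f ->
  ccontinuous (fun x => cintegral mu H (fun y => f y * ((x + y)^-1)%:C)) x.
Proof.
move=> x0 [fr fi]; split => /=.
  rewrite (_ : (fun y => _) = fun x => Rintegral mu H (fun y => complex.Re (f y) * (x + y)^-1)).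
    exact: continuous_cauchy fr.
  by apply/funext => y; apply: eq_Rintegral => z _; rewrite ReM /= mulr0 subr0.
rewrite (_ : (fun y => _) = fun x => Rintegral mu H (fun y => complex.Im (f y) * (x + y)^-1)).
  exact: continuous_cauchy fi.
by apply/funext => y; apply: eq_Rintegral => z _; rewrite ImM /= mulr0 add0r.
Qed.

(** The difference of steps lives between [s] and [s'], so the integral is an increment of a
    primitive of [g] and the fundamental theorem of calculus applies. The primitive starts at
    [s / 2] because [g] is controlled on positive reals only and may be singular at 0. *)
Lemma is_derive_step (g : R -> R) (s : R) : 0 < s ->
  (forall x, 0 < x -> {for x, continuous g}) ->
  is_derive s 1 (fun s' => Rintegral mu H
    (fun x => ((x <= s')%R%:R - (x <= s)%R%:R) * g x)) (g s).
Proof.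
move=> s0 cg; have u0 : 0 < s / 2 by rewrite divr_gt0.
have gi y : mu.-integrable `[s / 2, y] (EFin \o g).
  apply: continuous_compact_integrable; first exact: segment_compact.
  apply: continuous_in_subspaceT => x /set_mem; rewrite /= in_itv/= => /andP[sx _].
  by apply: cg; exact: lt_le_trans sx.
pose F y := Rintegral mu `[s / 2, y] g.
have ss1 : s < s + 1 by rewrite ltrDl.
have s2s : s / 2 < s by lra.
have [dF F's] := continuous_FTC1_closed ss1 (gi (s + 1)) s2s (cg _ s0).
have FD : is_derive s 1 (fun y => F y - F s) (g s).
  have FD : is_derive s 1 F (g s) by apply: DeriveDef => //; rewrite -derive1E.
  by rewrite -[g s]subr0; apply: is_deriveB.
apply: near_eq_is_derive FD; near=> y.
have sy : s / 2 < y by near: y; exact: lt_nbhsr.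
transitivity (Rintegral mu setT (g \_ `[s / 2, y]) -
    Rintegral mu setT (g \_ `[s / 2, s])).
  by congr (_ - _); exact: Rintegral_mkcond.
have gR z : mu.-integrable setT (EFin \o (g \_ `[s / 2, z])).
  have := (@integrable_mkcond _ _ _ mu [set` `[s / 2, z]] (EFin \o g)
    (measurable_itv _)).1 (gi z).
  by rewrite restrict_EFin.
rewrite -(RintegralB measurableT (gR y) (gR s)).
rewrite [RHS]Rintegral_mkcond; apply: eq_Rintegral => x _.
rewrite !patchE.
have itvE z : (x \in [set` `[s / 2, z]]) = (s / 2 <= x <= z).
  by apply/idP/idP => [/set_mem|h]; [rewrite /= in_itv|apply/mem_set; rewrite /= in_itv].
rewrite !itvE; have [sx|xs] /= := leP (s / 2) x.
  rewrite mem_set; last exact: lt_le_trans u0 sx.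
  by rewrite mulrBl; case: leP => _; case: leP => _; rewrite ?mul1r ?mul0r.
(* Below [s / 2] both steps equal 1 and cancel; this is where [s / 2 < y] matters. *)
rewrite (ltW (lt_trans xs sy)) (ltW (lt_trans xs s2s)) !subrr mul0r.
by case: ifP.
Unshelve. all: by end_near. Qed.

(** The weight is cut above the jump, so the indicator of [x > s] is written as one minus that of
    [x <= s]. This turns the sign in front of [c] positive. *)
Lemma weightB (c e : R[i]) (s s' x : R) : weight c s' e x - weight c s e x =
  ((x <= s')%R%:R - (x <= s)%R%:R : R)%:C * (c * laguerre e x).
Proof.
rewrite /weight rmorphB /= !rmorph_nat.
by case: (leP x s') => _; case: (leP x s) => _ /=; ring.
Qed.

(** Subtracting the weight at the base point leaves an integrand supported between [s] and [s'], so
    continuity of [f] suffices and no integrability against the weight is asked for. *)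
Lemma cis_derive_weight (c e : R[i]) (s : R) (f : R -> R[i]) : 0 < s ->
  (forall x, 0 < x -> ccontinuous f x) ->
  cis_derive (fun s' => cintegral mu H (fun x =>
    (weight c s' e x - weight c s e x) * f x)) s (c * laguerre e s * f s).
Proof.
move=> s0 cf; pose g x := c * laguerre e x * f x.
have cg x : 0 < x -> ccontinuous g x.
  move=> x0; apply: ccontinuousM (cf _ x0); apply: ccontinuousM.
    exact: ccontinuous_cst.
  exact: ccontinuous_laguerre.
have gE s' x : (weight c s' e x - weight c s e x) * f x =
    ((x <= s')%R%:R - (x <= s)%R%:R : R)%:C * g x.
  by rewrite weightB /g; ring.
split => /=.
  have := is_derive_step s0 (fun x x0 => (cg x x0).1).
  rewrite /g; apply: near_eq_is_derive; near=> s'; apply: eq_Rintegral => x _.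
  by rewrite gE [RHS]ReM /= mul0r subr0.
have := is_derive_step s0 (fun x x0 => (cg x x0).2).
rewrite /g; apply: near_eq_is_derive; near=> s'; apply: eq_Rintegral => x _.
by rewrite gE [RHS]ImM /= mul0r addr0.
Unshelve. all: by end_near. Qed.

End HalflineIntegral.

(** * Moments and Cauchy pairings *)

Section Moments.
Context (R : realType).
Local Notation mu := (@lebesgue_measure R).
Local Notation mu2 := (mu \x mu)%E.
Local Notation H := (@halfline R).
Implicit Types (w v : R -> R[i]) (f g p : {poly R[i]}).

Let mH : measurable H. Proof. exact: measurable_halfline. Qed.
Let mQ : measurable (@quadrant R). Proof. exact: measurable_quadrant. Qed.

Definition has_moments w :=
  forall j, cintegrable mu H (fun x => w x * x%:C ^+ j).

Lemma cintegrable_poly w p : has_moments w ->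
  cintegrable mu H (fun x => w x * p.[x%:C]).
Proof.
move=> wi; have := cintegrable_sum mH (index_enum 'I_(size p)) (fun j => p`_j)
  (fun j : 'I_(size p) => wi j).
apply: (eq_cintegrable mH) => x _; rewrite horner_coef mulr_sumr.
by apply: eq_bigr => j _; ring.
Qed.

Lemma mean_lform w p : has_moments w ->
  mean w p = lform (fun j => mean w 'X^j) p.
Proof.
move=> wi; transitivity (\sum_(j < size p) p`_j *
    cintegral mu H (fun x => w x * x%:C ^+ j)).
  rewrite -cintegral_sum//; apply: eq_cintegral => x _.
  rewrite horner_coef mulr_sumr; apply: eq_bigr => j _; ring.
apply: eq_bigr => j _; congr (_ * _); apply: eq_cintegral => x _.
by rewrite hornerXn.
Qed.

Lemma second_kindE w p (s : R) : has_moments w -> 0 < s ->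
  second_kind w p (- s%:C) =
  - cintegral mu H (fun y => w y * p.[y%:C] * ((s + y)^-1)%:C).
Proof.
move=> wi s0; rewrite -[RHS]mulN1r -(cintegralZ mH)//; last first.
  exact: cintegrable_cauchy s0 (cintegrable_poly _ wi).
apply: eq_cintegral => y y0; rewrite -opprD -rmorphD/= invrN fmorphV/=; ring.
Qed.

Lemma second_kind_lform w p (s : R) : has_moments w -> 0 < s ->
  second_kind w p (- s%:C) = lform (fun k => second_kind w 'X^k (- s%:C)) p.
Proof.
move=> wi s0; rewrite second_kindE//.
transitivity (- \sum_(j < size p) p`_j *
    cintegral mu H (fun y => w y * ('X^j).[y%:C] * ((s + y)^-1)%:C)).
  rewrite -cintegral_sum//; last first.
    by move=> j; exact: cintegrable_cauchy s0 (cintegrable_poly _ wi).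
  congr (- _); apply: eq_cintegral => y _.
  rewrite horner_coef mulr_sumr mulr_suml; apply: eq_bigr => j _.
  by rewrite hornerXn; ring.
rewrite -sumrN; apply: eq_bigr => j _.
by rewrite (second_kindE 'X^j wi s0) mulrN.
Qed.

(** From [y = (s + y) - s], the first part cancelling the denominator. This is [beta_shift] with
    [sigma = -s] and [eps = 1]. *)
Lemma second_kindXM w p (s : R) : has_moments w -> 0 < s ->
  second_kind w ('X * p) (- s%:C) = - s%:C * second_kind w p (- s%:C) - mean w p.
Proof.
move=> wi s0; rewrite !second_kindE// mulrNN -(cintegralZ mH)//; last first.
  exact: cintegrable_cauchy s0 (cintegrable_poly _ wi).
rewrite -cintegralB//; last 2 first.
- by apply: (cintegrableZ mH); exact: cintegrable_cauchy s0 (cintegrable_poly _ wi).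
- exact: cintegrable_poly.
rewrite -[LHS]mulN1r -(cintegralZ mH)//; last first.
  exact: cintegrable_cauchy s0 (cintegrable_poly _ wi).
apply: eq_cintegral => y y0; rewrite hornerM hornerX !fmorphV rmorphD/=.
have sy0 : s%:C + y%:C != 0.
  by rewrite -rmorphD (fmorph_eq0 (real_complex R)) gt_eqF// addr_gt0.
by field.
Qed.

Definition all_finite w v := forall j k, pairing_finite w v 'X^j 'X^k.

(** The double sum is flattened to one over pairs of indices, so that linearity of the integral is
    used only once. *)
Lemma pairing_funE w v f g q : pairing_fun w v f g q =
  \sum_(i : 'I_(size f) * 'I_(size g)) (f`_i.1 * g`_i.2) * pairing_fun w v 'X^(i.1) 'X^(i.2) q.
Proof.
rewrite -(pair_big xpredT xpredT (fun (j : 'I_(size f)) (k : 'I_(size g)) =>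
  (f`_j * g`_k) * pairing_fun w v 'X^j 'X^k q))/=.
rewrite /pairing_fun (horner_coef f) (horner_coef g) -mulrA big_distrlr/= mulr_sumr.
apply: eq_bigr => j _; rewrite mulr_sumr; apply: eq_bigr => k _.
by rewrite !hornerXn; ring.
Qed.

Lemma pairing_finite_poly w v f g : all_finite w v -> pairing_finite w v f g.
Proof.
move=> fin; have := cintegrable_sum mQ (index_enum _)
  (fun i : 'I_(size f) * 'I_(size g) => f`_i.1 * g`_i.2) (fun i => fin i.1 i.2).
by apply: (eq_cintegrable mQ) => q _; rewrite pairing_funE.
Qed.

Lemma pairing_bform w v f g : all_finite w v ->
  pairing w v f g = bform (moment w v) f g.
Proof.
move=> fin; transitivity (\sum_(i : 'I_(size f) * 'I_(size g))
    f`_i.1 * g`_i.2 * moment w v i.1 i.2).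
  rewrite /moment /pairing -(cintegral_sum mQ); last by move=> i; exact: fin.
  by apply: eq_cintegral => q _; exact: pairing_funE.
rewrite (bformE _ (leqnn _) (leqnn _)).
rewrite -(pair_big xpredT xpredT (fun (j : 'I_(size f)) (k : 'I_(size g)) =>
  (f`_j * g`_k) * moment w v j k))/=.
by apply: eq_bigr => j _; apply: eq_bigr => k _; rewrite mulrA.
Qed.

Lemma pairing_fun_swap w v f g (q : R * R) :
  pairing_fun v w g f q = pairing_fun w v f g (q.2, q.1).
Proof. by rewrite /pairing_fun /= [q.1 + q.2]addrC; ring. Qed.

Lemma all_finite_swap w v : all_finite w v -> all_finite v w.
Proof.
move=> fin j k; have := cintegrable_quadrant_swap (fin k j).
by apply: (eq_cintegrable mQ) => q _; rewrite (pairing_fun_swap w v).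
Qed.

Lemma pairing_swap w v f g : all_finite w v -> pairing v w g f = pairing w v f g.
Proof.
move=> fin; rewrite -[RHS](cintegral_quadrant_swap (pairing_finite_poly f g fin)).
by apply: eq_cintegral => q _; rewrite (pairing_fun_swap w v).
Qed.

Lemma partition_function_swap w v n : all_finite w v ->
  partition_function v w n = partition_function w v n.
Proof.
move=> fin; rewrite /partition_function -det_tr; congr (\det _).
by apply/matrixP => j k; rewrite !mxE /moment (pairing_swap _ _ fin).
Qed.

Lemma pairing_funXM w v f g q : quadrant q ->
  pairing_fun w v ('X * f) g q + pairing_fun w v f ('X * g) q =
  w q.1 * f.[q.1%:C] * (v q.2 * g.[q.2%:C]).
Proof.
move=> [x0 y0]; rewrite /pairing_fun !hornerM !hornerX.
rewrite rmorphD/=; have q0 : q.1%:C + q.2%:C != 0.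
  by rewrite -rmorphD (fmorph_eq0 (real_complex R)) gt_eqF// addr_gt0.
by field.
Qed.

(* Summing the two shifted pairings removes the Cauchy kernel, so [w (x) v] is
   integrable; a section at a point where [v] does not vanish is a multiple of
   [w]. *)
Lemma all_finite_has_moments w v (t : R) : 0 < t ->
  (forall y, 0 < y < t -> v y != 0) -> all_finite w v -> has_moments w.
Proof.
move=> t0 v0 fin j.
have Fi : cintegrable mu2 (@quadrant R) (fun q => w q.1 * q.1%:C ^+ j * v q.2).
  have := cintegrableD mQ (pairing_finite_poly ('X * 'X^j) 1 fin)
    (pairing_finite_poly 'X^j ('X * 1) fin).
  by apply: (eq_cintegrable mQ) => q Qq; rewrite pairing_funXM// !hornerE /= mulr1.
have [Fr Fim] := Fi.
have [N [mN N0 Nsub]] : {ae mu, forall y, 0 < y ->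
    cintegrable mu H (fun x => w x * x%:C ^+ j * v y)}.
  apply: (filterS2 (ae_filter_ringOfSetsType mu) _
    (integrable_quadrant_section Fr) (integrable_quadrant_section Fim)).
  by move=> y /[swap] yi /[swap] y0 yr; split; [exact: yr|exact: yi].
(* The exceptional set is null while the interval from 0 to [t] has positive measure, so some
   section there is integrable. *)
have [y /andP[y0 yt] yi] : exists2 y, 0 < y < t &
    cintegrable mu H (fun x => w x * x%:C ^+ j * v y).
  apply: contrapT => no; have sN : [set` `]0%R, t[%R] `<=` N.
    apply: subset_trans Nsub => y; rewrite /= in_itv/= => yt h; apply: no.
    by exists y => //; apply: h; case/andP: yt.
  have : (mu [set` `]0%R, t[%R] <= mu N)%E.
    by have := le_measure mu (mem_set (measurable_itv _)) (mem_set mN) sN; exact.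
  by rewrite N0 lebesgue_measure_itv/= lte_fin t0 sube0 lee_fin leNgt t0.
apply: (eq_cintegrable mH) (cintegrableZ mH (v y)^-1 yi) => x _.
by rewrite [_ * v y]mulrC mulKf// v0// y0.
Qed.

(** The factor [x + y] cancels the Cauchy kernel, and Fubini splits the remaining product. This is
    [moment_shift] for the actual weights. *)
Lemma pairing_shift w v f g : all_finite w v -> has_moments w -> has_moments v ->
  pairing w v ('X * f) g + pairing w v f ('X * g) = mean w f * mean v g.
Proof.
move=> fin wi vi.
rewrite /pairing -cintegralD//; [|exact: pairing_finite_poly|exact: pairing_finite_poly].
transitivity (cintegral mu2 (@quadrant R)
    (fun q => w q.1 * f.[q.1%:C] * (v q.2 * g.[q.2%:C]))).
  by apply: eq_cintegral => q Qq; exact: pairing_funXM.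
rewrite cintegral_quadrant; last 2 first.
- have := cintegrableD mQ (pairing_finite_poly ('X * f) g fin)
    (pairing_finite_poly f ('X * g) fin).
  by apply: (eq_cintegrable mQ) => q Qq; exact: pairing_funXM.
- by move=> x x0 /=; apply: (cintegrableZ mH); exact: cintegrable_poly.
rewrite mulrC -(cintegralZ mH)//; last exact: cintegrable_poly.
apply: eq_cintegral => x x0 /=; rewrite (cintegralZ mH)//; last exact: cintegrable_poly.
by rewrite mulrC.
Qed.

Lemma cis_derive_mean (c e : R[i]) (s : R) (j : nat) : 0 < s ->
  (\forall s' \near s, has_moments (weight c s' e)) ->
  cis_derive (fun s' => mean (weight c s' e) 'X^j) s (c * laguerre e s * s%:C ^+ j).
Proof.
move=> s0 wi; have wi0 := nbhs_singleton wi.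
have := cis_deriveD (cis_derive_weight c e s0 (fun x _ => ccontinuousX j x))
  (cis_derive_cst s (mean (weight c s e) 'X^j)).
rewrite addr0; apply: cis_derive_near; apply: filterS wi => s' wi'.
rewrite -(cintegralD mH).
- by apply: eq_cintegral => x _; rewrite hornerXn; ring.
- have := cintegrableB mH (wi' j) (wi0 j).
  by apply: (eq_cintegrable mH) => x _; ring.
- exact: cintegrable_poly.
Qed.

(** Integrating over [y] first leaves the Cauchy transform [h] of [v y^k], continuous on positive
    reals, and the jump then moves in a one-variable integral of [x^j h(x)]. The minus sign appears
    because the second-kind integral at [-s] is [- h(s)]. *)
Lemma cis_derive_moment (c e : R[i]) (s : R) v (j k : nat) : 0 < s ->
  (\forall s' \near s, all_finite (weight c s' e) v) -> has_moments v ->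
  cis_derive (fun s' => moment (weight c s' e) v j k) s
    (- (c * laguerre e s * s%:C ^+ j * second_kind v 'X^k (- s%:C))).
Proof.
move=> s0 fin vi; have fin0 := nbhs_singleton fin.
pose h x := cintegral mu H (fun y => v y * ('X^k).[y%:C] * ((x + y)^-1)%:C).
have ch x : 0 < x -> ccontinuous (fun x => x%:C ^+ j * h x) x.
  move=> x0; apply: ccontinuousM; first exact: ccontinuousX.
  by apply: ccontinuous_cauchy => //; exact: cintegrable_poly.
have := cis_deriveD (cis_derive_weight c e s0 ch)
  (cis_derive_cst s (moment (weight c s e) v j k)).
have -> : - (c * laguerre e s * s%:C ^+ j * second_kind v 'X^k (- s%:C)) =
    c * laguerre e s * (s%:C ^+ j * h s).
  by rewrite (second_kindE _ vi s0) -/(h s); ring.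
rewrite addr0; apply: cis_derive_near; apply: filterS fin => s' fin'.
apply/eqP; rewrite eq_sym -subr_eq; apply/eqP.
rewrite /moment /pairing -(cintegralB mQ); [|exact: fin'|exact: fin0].
pose F (q : R * R) := (weight c s' e q.1 - weight c s e q.1) * q.1%:C ^+ j *
  (v q.2 * ('X^k).[q.2%:C] * ((q.1 + q.2)^-1)%:C).
have FE q : pairing_fun (weight c s' e) v 'X^j 'X^k q -
    pairing_fun (weight c s e) v 'X^j 'X^k q = F q.
  by rewrite /pairing_fun /F !hornerXn fmorphV/=; ring.
transitivity (cintegral mu2 (@quadrant R) F).
  by apply: eq_cintegral => q _; exact: FE.
rewrite cintegral_quadrant.
- apply: eq_cintegral => x x0; rewrite /F/= (cintegralZ mH).
    by rewrite -/(h x); ring.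
  by apply: cintegrable_cauchy => //; exact: cintegrable_poly.
- have := cintegrableB mQ (fin' j k) (fin0 j k).
  by apply: (eq_cintegrable mQ) => q _; exact: FE.
- move=> x x0; rewrite /F/=; apply: (cintegrableZ mH).
  by apply: cintegrable_cauchy => //; exact: cintegrable_poly.
Qed.

End Moments.

(** * The evolution equations *)

Section CauchyBiorthogonal.
Context (R : realType).
Implicit Types (w v : R -> R[i]) (p : {poly R[i]}).

(** The conditions at a single parameter value, in a form stable under exchanging the weights
    together with [P] and [Q]. *)
Definition cauchy_biorthogonal w v (P Q : nat -> {poly R[i]}) (S : nat -> R[i]) :=
  [/\ all_finite w v /\ (has_moments w /\ has_moments v),
      forall n, partition_function w v n != 0,
      (forall n, size (P n) = n.+1) /\ (forall n, size (Q n) = n.+1),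
      (forall n, lead_coef (P n) = S n) /\ (forall n, lead_coef (Q n) = S n) &
      forall m n, pairing w v (P m) (Q n) = (m == n)%:R].

Lemma cauchy_biorthogonal_swap w v P Q S :
  cauchy_biorthogonal w v P Q S -> cauchy_biorthogonal v w Q P S.
Proof.
move=> [[fin [wi vi]] Z [sP sQ] [lP lQ] o]; split=> //.
- by split=> //; exact: all_finite_swap.
- by move=> n; rewrite (partition_function_swap _ fin).
- by move=> m n; rewrite (pairing_swap _ _ fin) o eq_sym.
Qed.

Lemma vis_derive_near m (f g : R -> 'cV[R[i]]_m) (x : R) l :
  (\forall y \near x, f y = g y) -> vis_derive f x l -> vis_derive g x l.
Proof.
by move=> fg fl i; apply: cis_derive_near (fl i); apply: filterS fg => y ->.
Qed.

Context (c e : R[i]) (x : R).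
Hypothesis x_gt0 : 0 < x.
Variables (P Q : R -> nat -> {poly R[i]}) (S : R -> nat -> R[i]).
Hypothesis dS : forall n, cderivable x (fun y => S y n).

(** The jump moves in the weight that defines the mean. In [derive_mean_vec], [alpha] is evaluation
    at [x] and [beta] the second-kind functional at [-x]; [eps = 1] because the mean itself varies
    with the jump. *)
Lemma derive_mean_own v n :
  (\forall y \near x, cauchy_biorthogonal (weight c y e) v (P y) (Q y) (S y)) ->
  (forall k, mean v (Q x k) != 0) ->
  let u k := (P x k).[x%:C] in
  let u' k := second_kind v (Q x k) (- x%:C) in
  vis_derive (fun y => vec3 (fun k => mean (weight c y e) (P y k)) n) x
    (coef_mx (c * laguerre e x) u u' (- 2 * prev u n * u' n) n *m
       vec3 (fun k => mean (weight c x e) (P x k)) n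
     - (c * laguerre e x * (mean v (Q x n))^-1 *
        bracket (S x) (pairing (weight c x e) v ('X * P x n) (Q x n) - x%:C) u' n)
       *: vec3 u n).
Proof.
move=> bo E0 u u'.
have [[fin0 [wi0 vi]] _ _ _ _] := nbhs_singleton bo.
pose al j := x%:C ^+ j; pose be k := second_kind v 'X^k (- x%:C).
pose m y j := mean (weight c y e) 'X^j.
have uE : u = fun k => lform al (P x k) by apply/funext => k; rewrite lform_horner.
have u'E : u' = fun k => lform be (Q x k).
  by apply/funext => k; rewrite /u' second_kind_lform.
have mE : (fun k => mean (weight c x e) (P x k)) = fun k => lform (m x) (P x k).
  by apply/funext => k; rewrite mean_lform.
rewrite uE u'E mE (pairing_bform _ _ fin0).
apply: (@vis_derive_near _ (fun y => vec3 (fun k => lform (m y) (P y k)) n)).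
  apply: filterS bo => y [[_ [wi _]] _ _ _ _]; congr vec3; apply/funext => k.
  by rewrite mean_lform.
apply: (@derive_mean_vec R x (fun y => moment (weight c y e) v) m P Q S
    _ _ _ _ _ _ _ 1 al be).
- by apply: filterS bo => y [_ _ []].
- by apply: filterS bo => y [_ _ []].
- by apply: filterS bo => y [_ _ _ []].
- by apply: filterS bo => y [_ _ _ []].
- by apply: filterS bo => y [[fin _] _ _ _ o] k l; rewrite -pairing_bform.
- by apply: filterS bo => y [].
- move=> j k; apply: cis_derive_moment => //.
  by apply: filterS bo => y [[]].
- move=> j; rewrite mulr1; apply: cis_derive_mean => //.
  by apply: filterS bo => y [[_ []]].
- exact: dS.
- move=> f g; rewrite -!pairing_bform// pairing_shift// mean_lform//.
- move=> g; rewrite -!second_kind_lform// second_kindXM// mul1r//.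
- exact: E0.
Qed.

(** The jump moves in the opposite weight: [alpha] and [beta] exchange their roles, and [eps = 0]
    because the moments of the mean are constant. *)
Lemma derive_mean_other w n :
  (\forall y \near x, cauchy_biorthogonal w (weight c y e) (P y) (Q y) (S y)) ->
  (forall k, mean (weight c x e) (Q x k) != 0) ->
  let u k := second_kind w (P x k) (- x%:C) in
  let u' k := (Q x k).[x%:C] in
  vis_derive (fun y => vec3 (fun k => mean w (P y k)) n) x
    (coef_mx (c * laguerre e x) u u' (- 2 * prev u n * u' n) n *m
       vec3 (fun k => mean w (P x k)) n
     - (c * laguerre e x * (mean (weight c x e) (Q x n))^-1 *
        bracket (S x) (pairing w (weight c x e) ('X * P x n) (Q x n) + x%:C) u' n)
       *: vec3 u n).
Proof.
move=> bo E0 u u'.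
have [[fin0 [wi vi]] _ _ _ _] := nbhs_singleton bo.
pose al j := second_kind w 'X^j (- x%:C); pose be k := x%:C ^+ k.
pose m (_ : R) j := mean w 'X^j.
have uE : u = fun k => lform al (P x k).
  by apply/funext => k; rewrite /u second_kind_lform.
have u'E : u' = fun k => lform be (Q x k) by apply/funext => k; rewrite lform_horner.
have mE y : (fun k => mean w (P y k)) = fun k => lform (m y) (P y k).
  by apply/funext => k; rewrite mean_lform.
rewrite uE u'E mE (pairing_bform _ _ fin0).
rewrite (_ : (fun y => _) = fun y => vec3 (fun k => lform (m y) (P y k)) n); last first.
  by apply/funext => y; rewrite mE.
apply: (@derive_mean_vec R x (fun y => moment w (weight c y e)) m P Q S
    _ _ _ _ _ _ _ 0 al be).
- by apply: filterS bo => y [_ _ []].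
- by apply: filterS bo => y [_ _ []].
- by apply: filterS bo => y [_ _ _ []].
- by apply: filterS bo => y [_ _ _ []].
- by apply: filterS bo => y [[fin _] _ _ _ o] k l; rewrite -pairing_bform.
- by apply: filterS bo => y [].
(* The jump sits in the second weight, so the weights are exchanged before differentiating the
   moment and exchanged back afterwards. *)
- move=> j k; have fin' : \forall y \near x, all_finite (weight c y e) w.
    by apply: filterS bo => y [[fin _] _ _ _ _]; exact: all_finite_swap.
  have := cis_derive_moment k j x_gt0 fin' wi.
  rewrite -/(al j) -/(be k) mulrAC; apply: cis_derive_near.
  by apply: filterS fin' => y fin; rewrite /moment (pairing_swap _ _ fin).
- by move=> j; rewrite mulr0 mul0r; exact: cis_derive_cst.
- exact: dS.
- move=> f g; rewrite -!pairing_bform// pairing_shift// mean_lform//.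
- by move=> g; rewrite !lform_horner hornerM hornerX mul0r subr0.
- exact: E0.
Qed.

End CauchyBiorthogonal.

(** Below the jump the factor in front is 1 for every [c], including [c = 1], which kills the weight
    above the jump. *)
Lemma weight_neq0 (R : realType) (c e : R[i]) (r x : R) : x < r -> weight c r e x != 0.
Proof.
move=> xr; rewrite /weight (lt_gtF xr) mulr0 subr0 mul1r; exact: laguerre_neq0.
Qed.

Lemma cdifferentiable_partial (R : realType) (f : R -> R -> R[i]) (s t : R) :
  cdifferentiable f (s, t) ->
  cderivable s (fun s' => f s' t) /\ cderivable t (fun t' => f s t').
Proof.
move=> [fr fi].
have d1 : differentiable (fun s' : R => (s', t)) s by apply: differentiable_pair.
have d2 : differentiable (fun t' : R => (s, t')) t by apply: differentiable_pair.
split.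
  exists ('D_1 (fun s' => complex.Re (f s' t)) s +i* 'D_1 (fun s' => complex.Im (f s' t)) s).
  split; apply: derivableP; apply/derivable1_diffP.
    exact: (differentiable_comp d1 fr).
  exact: (differentiable_comp d1 fi).
exists ('D_1 (fun t' => complex.Re (f s t')) t +i* 'D_1 (fun t' => complex.Im (f s t')) t).
split; apply: derivableP; apply/derivable1_diffP.
  exact: (differentiable_comp d2 fr).
exact: (differentiable_comp d2 fi).
Qed.

Theorem proposition4p14 (R : realType) (a b xi psi : R[i])
    (ha : -1 < complex.Re a) (hb : -1 < complex.Re b)
    (U : set (R * R))
    (S : R -> R -> nat -> R[i]) (P Q : R -> R -> nat -> {poly R[i]})
    (hUopen : open U)
    (hUpos : forall s t : R, U (s, t) -> 0 < s /\ 0 < t)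
    (hfin : forall (s t : R) (j k : nat), U (s, t) ->
      pairing_finite (w1 a xi s) (w2 b psi t) 'X^j 'X^k)
    (hZ : forall (s t : R) (n : nat), U (s, t) ->
      partition_function (w1 a xi s) (w2 b psi t) n != 0)
    (hS : forall (s t : R) (n : nat), U (s, t) ->
      S s t n ^+ 2 = partition_function (w1 a xi s) (w2 b psi t) n
                     / partition_function (w1 a xi s) (w2 b psi t) n.+1)
    (hSdiff : forall (s t : R) (n : nat), U (s, t) ->
      cdifferentiable (fun s' t' => S s' t' n) (s, t))
    (hPsize : forall (s t : R) (n : nat), U (s, t) -> size (P s t n) = n.+1)
    (hQsize : forall (s t : R) (n : nat), U (s, t) -> size (Q s t n) = n.+1)
    (hPlead : forall (s t : R) (n : nat), U (s, t) -> lead_coef (P s t n) = S s t n)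
    (hQlead : forall (s t : R) (n : nat), U (s, t) -> lead_coef (Q s t n) = S s t n)
    (hPQ : forall (s t : R) (m n : nat), U (s, t) ->
      pairing (w1 a xi s) (w2 b psi t) (P s t m) (Q s t n) = (m == n)%:R)
    (hpi : forall (s t : R) (n : nat), U (s, t) -> pi_ a xi P s t n != 0)
    (heta : forall (s t : R) (n : nat), U (s, t) -> eta_ b psi Q s t n != 0) :
  forall (s t : R) (n : nat), U (s, t) ->
  [/\ vis_derive (fun s' => vec3 (pi_ a xi P s' t) n) s
        (Binf0 a b xi psi P Q s t n *m vec3 (pi_ a xi P s t) n
         - (xi * laguerre a s * (eta_ b psi Q s t n)^-1
            * bracket (S s t) (Xdiag a b xi psi P Q s t n - s%:C)
                (Q1val b psi Q s t (- s%:C)) n)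
           *: vec3 (Pval P s t s%:C) n),
      vis_derive (fun t' => vec3 (pi_ a xi P s t') n) t
        (Cinf0 a b xi psi P Q s t n *m vec3 (pi_ a xi P s t) n
         - (psi * laguerre b t * (eta_ b psi Q s t n)^-1
            * bracket (S s t) (Xdiag a b xi psi P Q s t n + t%:C)
                (Qval Q s t t%:C) n)
           *: vec3 (P1val a xi P s t (- t%:C)) n),
      vis_derive (fun s' => vec3 (eta_ b psi Q s' t) n) s
        (Binf0bar a b xi psi P Q s t n *m vec3 (eta_ b psi Q s t) n
         - (xi * laguerre a s * (pi_ a xi P s t n)^-1
            * bracket (S s t) (Ydiag a b xi psi P Q s t n + s%:C)
                (Pval P s t s%:C) n)
           *: vec3 (Q1val b psi Q s t (- s%:C)) n) &
      vis_derive (fun t' => vec3 (eta_ b psi Q s t') n) t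
        (Cinf0bar a b xi psi P Q s t n *m vec3 (eta_ b psi Q s t) n
         - (psi * laguerre b t * (pi_ a xi P s t n)^-1
            * bracket (S s t) (Ydiag a b xi psi P Q s t n - t%:C)
                (P1val a xi P s t (- t%:C)) n)
           *: vec3 (Qval Q s t t%:C) n)].

Proof.
have bo s t : U (s, t) -> cauchy_biorthogonal (w1 a xi s) (w2 b psi t)
    (P s t) (Q s t) (S s t).
  move=> Ust; have [s0 t0] := hUpos _ _ Ust.
  have fin : all_finite (w1 a xi s) (w2 b psi t) by move=> j k; exact: hfin.
  split=> [|n|||m n]; [split=> //; split|exact: hZ| | |exact: hPQ].
  (* Moments of each weight come from finiteness of the pairing, since the other weight does not
     vanish below its own jump. *)
  - apply: (all_finite_has_moments t0 _ fin) => y /andP[_ yt].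
    exact: weight_neq0.
  - apply: (all_finite_has_moments s0 _ (all_finite_swap fin)) => y /andP[_ ys].
    exact: weight_neq0.
  - by split=> n; [exact: hPsize|exact: hQsize].
  - by split=> n; [exact: hPlead|exact: hQlead].
move=> s t n Ust; have [s0 t0] := hUpos _ _ Ust.
have Us : \forall s' \near s, U (s', t).
  have c1 : {for s, continuous (fun s' : R => (s', t))}.
    by apply: differentiable_continuous; exact: differentiable_pair.
  by apply: c1; exact: open_nbhs_nbhs.
have Ut : \forall t' \near t, U (s, t').
  have c2 : {for t, continuous (fun t' : R => (s, t'))}.
    by apply: differentiable_continuous; exact: differentiable_pair.
  by apply: c2; exact: open_nbhs_nbhs.
have dS1 k := (cdifferentiable_partial (hSdiff _ _ k Ust)).1.
have dS2 k := (cdifferentiable_partial (hSdiff _ _ k Ust)).2.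
have [[fin _] _ _ _ _] := bo _ _ Ust.
(* Exchanging [u] and [v] leaves the diagonal alone and turns the (3,2) entry of the barred matrices
   into the one produced by the general lemmas. *)
have coef_swap (d : R[i]) (u v : nat -> R[i]) :
    coef_mx d u v (- 2 * u n * prev v n) n = coef_mx d v u (- 2 * prev v n * u n) n.
  rewrite /coef_mx; congr (_ *: _); apply/matrixP => i j; rewrite !mxE.
  by rewrite [u n.+1 * _]mulrC [u n * v n]mulrC [prev u n * _]mulrC mulrAC.
split.
- apply: (derive_mean_own s0 (P := fun s' => P s' t) (Q := fun s' => Q s' t)
    (S := fun s' => S s' t) dS1 n) => [|k]; last exact: heta.
  by apply: filterS Us => s' Us'; exact: bo.
- apply: (derive_mean_other t0 (P := P s) (Q := Q s) (S := S s) dS2 n) => [|k].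
    by apply: filterS Ut => t' Ut'; exact: bo.
  exact: heta.
(* With the weights exchanged, [eta] becomes the mean for the first weight and [Y_(n,n)] takes the
   place of [X_(n,n)]; the jump at [s] then belongs to the opposite weight, the jump at [t] to its
   own. *)
- rewrite /Binf0bar coef_swap /Ydiag -(pairing_swap _ _ fin).
  apply: (derive_mean_other s0 (P := fun s' => Q s' t) (Q := fun s' => P s' t)
    (S := fun s' => S s' t) dS1 n) => [|k]; last exact: hpi.
  by apply: filterS Us => s' Us'; exact/cauchy_biorthogonal_swap/bo.
- rewrite /Cinf0bar coef_swap /Ydiag -(pairing_swap _ _ fin).
  apply: (derive_mean_own t0 (P := Q s) (Q := P s) (S := S s) dS2 n) => [|k].
    by apply: filterS Ut => t' Ut'; exact/cauchy_biorthogonal_swap/bo.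
  exact: hpi.
Qed.
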